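(* Let $c_0\in\mathbb C$, $b_0\in\mathbb C^n$, and let $u$ be a solution in $\mathbb R^n\times[0,\infty)$ of $$u_t+\Delta u=c_0u+\langle b_0,\nabla u\rangle$$ such that $u(\cdot,0)\not\equiv0$ and such that for some $C\ge0$ one has, for all $x\in\mathbb R^n$ and $t\in[0,\infty)$, $$|u(x,t)|\le Ce^{C(|x|+|t|^{1/2})}.$$ Then there exists a constant $\tilde C>0$, depending only on $n$, $C$, $|b_0|$, $|c_0|$ and $\int_{B_1}|u(x,0)|^2dx$, such that for all $x_0\in\mathbb R^n$ with $|x_0|=R$ sufficiently large, $$\int_{B_1(x_0)}|u(x,0)|^2\,dx\ge e^{-\tilde CR\log R}.$$
   Context: $B_r(x)$ is the ball in $\mathbb R^n$ of radius $r$ centred at $x$, $B_1=B_1(0)$; $\Delta$ and $\nabla$ are in the $x$ variable; $\langle b_0,\nabla u\rangle=\sum_{j=1}^n(b_0)_j\,\partial_{x_j}u$. *)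

(* Defs.v *)
From HB Require Import structures.
From mathcomp Require Import all_boot all_order all_algebra.
From mathcomp Require Import all_classical all_reals all_analysis.
From mathcomp Require Import complex.

Set Implicit Arguments.
Unset Strict Implicit.
Unset Printing Implicit Defensive.
Import Order.TTheory GRing.Theory Num.Theory.
Import numFieldNormedType.Exports.

Local Open Scope classical_set_scope.
Local Open Scope ring_scope.
Local Open Scope complex_scope.

(* Points of R^n are row vectors 'rV[R]_n. The library norm on matrices is the
   sup norm (it induces the same topology), hence the Euclidean norm below. *)
Definition enorm (R : realType) (n : nat) (x : 'rV[R]_n) : R :=
  Num.sqrt (\sum_(j < n) x 0 j ^+ 2).

Definition eball (R : realType) (n : nat) (x : 'rV[R]_n) (r : R) :
  set 'rV[R]_n := [set y | enorm (y - x) < r].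

(* The norm of R[i] in the library takes its values in R[i]; cmod is R-valued. *)
Definition cmod (R : realType) (z : R[i]) : R := Normc.normc z.

Definition cenorm (R : realType) (n : nat) (b : 'rV[R[i]]_n) : R :=
  Num.sqrt (\sum_(j < n) cmod (b 0 j) ^+ 2).

Section lebesgue_tuple.
Context (R : realType).
Local Open Scope ereal_scope.
Local Notation T := (measurableTypeR R).

Definition tuple_consp (n : nat) (p : T * n.-tuple T) : n.+1.-tuple T :=
  [tuple of p.1 :: p.2].

(* n-dimensional Lebesgue measure, on the product sigma-algebra of n.-tuple R
   (the library has no measurable structure on 'rV[R]_n). *)
Fixpoint lebesgue_tuple (n : nat) : set (n.-tuple T) -> \bar R :=
  match n with
  | 0%N => \d_([tuple] : 0.-tuple T)
  | n'.+1 => pushforward (@lebesgue_measure R \x @lebesgue_tuple n')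
               (@tuple_consp n')
  end.

Lemma measurable_tuple_consp n : measurable_fun setT (@tuple_consp n).
Proof. exact: measurable_cons measurable_fst measurable_snd. Qed.

Lemma tuple_conspE n (A : set T) (B : set (n.-tuple T)) :
  @tuple_consp n @^-1` [set t | A (thead t) /\ B [tuple of behead t]] = A `*` B.
Proof.
have bE x (t : n.-tuple T) : [tuple of behead (@tuple_consp n (x, t))] = t.
  exact/val_inj.
by apply/seteqP; split=> -[x t] /=; rewrite bE.
Qed.

Lemma lebesgue_tuple_sigma_finite n :
  exists mu : {sigma_finite_measure set (n.-tuple T) -> \bar R},
    @lebesgue_tuple n = mu :> (set (n.-tuple T) -> \bar R).
Proof.
elim: n => [|n [mu IHmu]]; first by exists \d_([tuple] : 0.-tuple T).
have /sigma_finiteP[F [TF ndF mF]] := sigma_finiteT (@lebesgue_measure R).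
have /sigma_finiteP[G [TG ndG mG]] := sigma_finiteT mu.
pose m : {measure set _ -> \bar R} := @lebesgue_measure R \x mu.
pose nuf := [the {measure set _ -> \bar R} of pushforward m (@tuple_consp n)].
pose nu : {measure set _ -> \bar R} := nuf (@measurable_tuple_consp n).
have snu : sigma_finite setT nu.
  exists (fun k => [set t | F k (thead t) /\ G k [tuple of behead t]]).
    apply/seteqP; split=> // t _.
    have [i _ Fi] : (\bigcup_i F i) (thead t) by rewrite -TF.
    have [j _ Gj] : (\bigcup_i G i) [tuple of behead t] by rewrite -TG.
    exists (maxn i j) => //; split.
      by have /subsetPset := ndF _ _ (leq_maxl i j); exact.
    by have /subsetPset := ndG _ _ (leq_maxr i j); exact.
  move=> k; have [mFk Fk] := mF k; have [mGk Gk] := mG k; split.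
    apply: measurableI.
      by rewrite -[X in measurable X]setTI; exact: measurable_tnth.
    by rewrite -[X in measurable X]setTI; exact: measurable_behead.
  rewrite /nu /= /pushforward tuple_conspE product_measure1E//.
  by apply: lte_mul_pinfty => //; rewrite ge0_fin_numE.
pose H := @Measure_isSigmaFinite.Build _ _ R nu snu.
pose nu' : {sigma_finite_measure set (n.+1.-tuple T) -> \bar R} :=
  HB.pack (nu : set _ -> \bar R) (Measure.class nu) H.
by exists nu'; rewrite /= IHmu.
Qed.

Let lebesgue_tuple0 n : @lebesgue_tuple n set0 = 0.
Proof. by have [mu ->] := lebesgue_tuple_sigma_finite n; exact: measure0. Qed.

Let lebesgue_tuple_ge0 n A : 0 <= @lebesgue_tuple n A.
Proof. by have [mu ->] := lebesgue_tuple_sigma_finite n; exact: measure_ge0. Qed.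

Let lebesgue_tuple_sigma_additive n : semi_sigma_additive (@lebesgue_tuple n).
Proof.
have [mu ->] := lebesgue_tuple_sigma_finite n.
exact: measure_semi_sigma_additive.
Qed.

HB.instance Definition _ n := isMeasure.Build _ _ _ (@lebesgue_tuple n)
  (@lebesgue_tuple0 n) (@lebesgue_tuple_ge0 n) (@lebesgue_tuple_sigma_additive n).

Let lebesgue_tuple_sigma_finiteT n : sigma_finite setT (@lebesgue_tuple n).
Proof.
have [mu ->] := lebesgue_tuple_sigma_finite n; exact: sigma_finiteT.
Qed.

HB.instance Definition _ n := Measure_isSigmaFinite.Build _ _ _
  (@lebesgue_tuple n) (@lebesgue_tuple_sigma_finiteT n).

End lebesgue_tuple.

(* \int_A f dx over a subset A of R^n, for a nonnegative f *)
Definition integral_rV (R : realType) (n : nat) (A : set 'rV[R]_n)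
    (f : 'rV[R]_n -> R) : \bar R :=
  let vec (t : n.-tuple (measurableTypeR R)) : 'rV[R]_n := \row_j tnth t j in
  (\int[@lebesgue_tuple R n]_(t in vec @^-1` A) (f (vec t))%:E)%E.

(* R[i] carries no normed R-module structure, so differentiability, derivatives
   and continuity of complex-valued functions are taken on real and imaginary
   parts. *)
Definition cderivable (R : realType) (V : normedModType R) (f : V -> R[i])
    (x v : V) : Prop :=
  derivable (fun y => complex.Re (f y)) x v /\
  derivable (fun y => complex.Im (f y)) x v.

Definition cderive (R : realType) (V : normedModType R) (f : V -> R[i])
    (x v : V) : R[i] :=
  'D_v (fun y => complex.Re (f y)) x +i* 'D_v (fun y => complex.Im (f y)) x.

Section space_time.
Context (R : realType) (n : nat).
Implicit Types u : 'rV[R]_n -> R -> R[i].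

Definition dt u (x : 'rV[R]_n) (t : R) : R[i] := cderive (u x) t 1.

Definition dx (j : 'I_n) u (x : 'rV[R]_n) (t : R) : R[i] :=
  cderive (fun y => u y t) x (delta_mx 0 j).

Definition laplacian u (x : 'rV[R]_n) (t : R) : R[i] :=
  \sum_(j < n) dx j (dx j u) x t.

Definition ccontinuous_on (A : set ('rV[R]_n * R)) u : Prop :=
  {within A, continuous (fun p => complex.Re (u p.1 p.2))} /\
  {within A, continuous (fun p => complex.Im (u p.1 p.2))}.

(* u is of class C^{2,1} in {t > 0} *)
Definition C21 u : Prop :=
  let Q := [set p : 'rV[R]_n * R | 0 < p.2] in
  [/\ forall x t, 0 < t ->
        [/\ cderivable (u x) t 1,
            forall j, cderivable (fun y => u y t) x (delta_mx 0 j)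
          & forall i j, cderivable (fun y => dx j u y t) x (delta_mx 0 i)],
      ccontinuous_on Q u,
      ccontinuous_on Q (dt u),
      forall j, ccontinuous_on Q (dx j u)
    & forall i j, ccontinuous_on Q (dx i (dx j u))].

(* Classical solutions in R^n x [0, oo): continuous up to t = 0, the equation
   being required at t > 0 only. Values of u at t < 0 are irrelevant. *)
Definition is_solution (c0 : R[i]) (b0 : 'rV[R[i]]_n) u : Prop :=
  [/\ ccontinuous_on [set p | 0 <= p.2] u,
      C21 u
    & forall x t, 0 < t ->
        dt u x t + laplacian u x t
          = c0 * u x t + \sum_(j < n) b0 0 j * dx j u x t].

End space_time.

(* Main.v *)
Require Import Defs.
From HB Require Import structures.
From mathcomp Require Import all_boot all_order all_algebra.
From mathcomp Require Import all_classical all_reals all_analysis.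
From mathcomp Require Import complex ring lra.
Import Order.TTheory GRing.Theory Num.Theory.
Import numFieldNormedType.Exports.
Set Implicit Arguments.
Unset Strict Implicit.
Unset Printing Implicit Defensive.
Local Open Scope classical_set_scope.
Local Open Scope ring_scope.
Local Open Scope complex_scope.

(** In reversed time, u is an ancient solution of a heat equation with lower
    order terms, of at most exponential growth.  Such a solution is extremely
    regular: u(., 0) behaves like the restriction to R^n of an entire function
    of exponential type.  If it were tiny on a unit ball at distance R, the
    three circles principle, with radii 1/2, R and 2R, would make it tiny on
    the unit ball at the origin as well; the logarithm log(4R) of the ratio
    of the radii is what produces the factor log R in the exponent.  The proof below implements
    this with finite differences in place of complex analysis.

    Regularity.  Let weight l x t = e^(lt) sum_j 2 cosh(l x_j), and consider
    the solutions w with |w| <= M weight l.  The main estimate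
    (vector_lipschitz) says that
      |w(x + v, t) - w(x, t)| <= A |v| M weight l x t
    with A independent of w and, above all, with the SAME weight on the right.
    Increments of w solve the same equation, since its coefficients are
    constant, so the estimate can be iterated: the N-th difference of u with
    step v is at most (A |v|)^N M weight l, up to t = 0 (iter_increment_at0).

    The main estimate is a maximum principle after doubling one variable.
    The function W(x, t, s) = w(x + s e_k, t) - w(x - s e_k, t) vanishes at
    s = 0 and, because its second derivatives in s and in x_k agree, it solves
    the equation in which d_k^2 is replaced by (d_k^2 + d_s^2) / 2.  On a strip
    0 <= s <= s0 that is narrow enough, d_s^2 applied to a concave profile in s
    beats every other term, growth in t included.  So weight l times such a
    profile is a barrier for all times at once, without any terminal
    condition, and |W| <= const * s * weight l (sym_diff_lipschitz).
    The coefficients being complex, the comparison is made with |W|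
    directly (max_point_ineq): the second order terms in |W| dominate the
    contribution of the imaginary part of b0.

    Extrapolation.  If a sequence has N-th differences at most eta and its
    values are at most eps at N consecutive places, then p steps before its
    values are controlled by both numbers (extrapolate_seq).  It is applied
    along the segment from x0 to a point y of the unit ball where u(y, 0) is
    not small, cut into N J steps with N and J of the order of R
    (extrapolate_at0).  The differences contribute (const R / N)^N, which is
    less than half of |u(y, 0)|, so some node close to x0 carries a value at
    least (const R)^(-N) = e^(-const R log R).

    Integrals.  The Lipschitz bound spreads this value to a small cube
    (integral_ge_point), and the given integral over the unit ball
    provides y (exists_point_of_integral).  If that integral is zero then so is
    u(., 0) near the origin, and the extrapolation, now with N tending to
    infinity, shows u(., 0) = 0 (zero_of_zero_on_cube), which is excluded. *)

(** * First and second order conditions at a maximum *)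

Lemma scale_realE (R : realType) (a b : R) : a *: (b : R^o) = a * b.
Proof. by []. Qed.

Lemma derive_gt0_right (R : realType) (f : R -> R) (x d : R) :
  is_derive x 1 f d -> 0 < d ->
  exists2 e : R, 0 < e & forall h, 0 < h < e -> f x < f (x + h).
Proof.
move=> [df <-] d0.
have := cvgr_gt _ df _ d0.
move=> [e /= e0 He]; exists e => // h /andP[h0 he].
have := He h; rewrite /ball_ /= sub0r normrN gtr0_norm// => /(_ he (lt0r_neq0 h0)).
rewrite /= -[h%:A]/(h * 1) mulr1 -[_ *: _]/(_ * _) pmulr_rgt0 ?invr_gt0// subr_gt0.
by rewrite addrC.
Qed.

(** The test in the time variable: only later times are compared, because the
    region of the maximum principle starts at a positive time. *)
Lemma right_max_derive_le0 (R : realType) (f : R -> R) (x d r : R) : 0 < r ->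
  is_derive x 1 f d -> (forall s, 0 < s < r -> f (x + s) <= f x) -> d <= 0.
Proof.
move=> r0 fd fmax; rewrite leNgt; apply/negP => /(derive_gt0_right fd)[e e0 He].
pose s := Num.min r e / 2.
have m0 : 0 < Num.min r e by rewrite lt_min r0.
have sm : s < Num.min r e by rewrite /s; lra.
move: sm; rewrite lt_min => /andP[sr se].
have s0 : 0 < s by rewrite /s; lra.
by have := fmax s; rewrite s0 sr => /(_ isT); rewrite leNgt He// s0.
Qed.

(** If d were positive, so would be g to the right of x, and by the mean value
    theorem f would exceed f x there. *)
Lemma max_derive_test (R : realType) (f g : R -> R) (x d r : R) : 0 < r ->
  (forall s, `|s - x| < r -> is_derive s 1 f (g s)) -> is_derive x 1 g d ->
  (forall s, `|s - x| < r -> f s <= f x) -> g x = 0 /\ d <= 0.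
Proof.
move=> r0 fg gd fmax.
have itvE s : s \in `]x - r, x + r[%R -> `|s - x| < r.
  by rewrite in_itv/= ltr_distl.
have gx : g x = 0.
  have xin : x \in `]x - r, x + r[%R by rewrite in_itv/=; lra.
  have fx := fg x (itvE _ xin).
  have := @derive1_at_max R f (x - r) (x + r) x ltac:(lra)
    (fun t h => ex_derive (is_derive := fg t (itvE _ h))) xin
    (fun t h => fmax t (itvE _ h)).
  by move=> /@derive_val <-; rewrite derive_val.
split => //; rewrite leNgt; apply/negP => /(derive_gt0_right gd)[e e0 He].
pose s := Num.min r e / 2.
have m0 : 0 < Num.min r e by rewrite lt_min r0.
have sm : s < Num.min r e by rewrite /s; lra.
move: sm; rewrite lt_min => /andP[sr se].
have s0 : 0 < s by rewrite /s; lra.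
have dist z : x <= z <= x + s -> `|z - x| < r.
  by move=> /andP[? ?]; rewrite ger0_norm; lra.
have [||z zin] := @MVT R f g x (x + s) ltac:(lra).
- by move=> z; rewrite in_itv/= => /andP[? ?]; apply/fg/dist; lra.
- apply: continuous_in_subspaceT => z; rewrite inE/= in_itv/= => zin.
  apply: differentiable_continuous; apply/derivable1_diffP.
  exact: (ex_derive (is_derive := fg z (dist _ zin))).
move: zin; rewrite in_itv/= => /andP[xz zs].
have fs : f (x + s) <= f x by apply: fmax; rewrite addrAC subrr add0r gtr0_norm.
have := He (z - x); rewrite gx [x + _]addrC subrK => /(_ ltac:(lra)) gz.
rewrite [x + s - x]addrAC subrr add0r => fE.
have : 0 < g z * s by apply: mulr_gt0.
by rewrite -fE subr_gt0 ltNge fs.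
Qed.

(** The touching condition for |W| = sqrt (P^2 + Q^2) and sqrt k * B is read on
    the squares, since |W| is not differentiable where W vanishes. *)
Lemma sq_max_test (R : realType) (P Q B P1 Q1 B1 : R -> R) (P2 Q2 B2 k x r : R) :
  0 < r ->
  (forall s, `|s - x| < r -> is_derive s 1 P (P1 s)) ->
  (forall s, `|s - x| < r -> is_derive s 1 Q (Q1 s)) ->
  (forall s, `|s - x| < r -> is_derive s 1 B (B1 s)) ->
  is_derive x 1 P1 P2 -> is_derive x 1 Q1 Q2 -> is_derive x 1 B1 B2 ->
  (forall s, `|s - x| < r ->
    P s ^+ 2 + Q s ^+ 2 - k * B s ^+ 2 <= P x ^+ 2 + Q x ^+ 2 - k * B x ^+ 2) ->
  P x * P1 x + Q x * Q1 x = k * (B x * B1 x) /\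
  P1 x ^+ 2 + P x * P2 + Q1 x ^+ 2 + Q x * Q2 <= k * (B1 x ^+ 2 + B x * B2).
Proof.
move=> r0 dP dQ dB dP1 dQ1 dB1 fmax.
have xx : `|x - x| < r by rewrite subrr normr0.
have [] := @max_derive_test R (fun s => P s ^+ 2 + Q s ^+ 2 - k * B s ^+ 2)
  (fun s => 2 * (P s * P1 s + Q s * Q1 s - k * (B s * B1 s))) x
  (2 * (P x * P2 + P1 x * P1 x + (Q x * Q2 + Q1 x * Q1 x)
   - k * (B x * B2 + B1 x * B1 x))) r r0 _ _ fmax.
- move=> s sr; have ? := dP s sr; have ? := dQ s sr; have ? := dB s sr.
  rewrite (_ : (fun s => _) = P ^+ 2 + Q ^+ 2 - k \*: (B ^+ 2)).
    by apply: is_derive_eq; rewrite !scale_realE ?expr1; ring.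
  by apply/funext => z; rewrite !(exprfctE, fctE).
- have ? := dP x xx; have ? := dQ x xx; have ? := dB x xx.
  rewrite (_ : (fun s => _) = 2 \*: (P * P1 + Q * Q1 - k \*: (B * B1))).
    by apply: is_derive_eq; rewrite !scale_realE; ring.
  by apply/funext => z.
by move=> E1 E2; split; [lra|move: E2; rewrite !expr2; lra].
Qed.

(** * The differential inequality at a touching point *)

(** Coefficient of d_j^2 in the equation with a doubled variable: half of d_k^2
    is replaced by half of d_s^2. *)
Definition half_at (R : realType) (n : nat) (k j : 'I_n) : R :=
  if j == k then 2^-1 else 1.

(** The last term on the left measures how fast the phase of P + i Q turns.  By
    |W|^2 |W1|^2 = (P P1 + Q Q1)^2 + (P Q1 - Q P1)^2 and the first order
    condition, it is the part of |W1|^2 which B does not see. *)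
Lemma second_order_gain (R : realType) (P Q P1 Q1 P2 Q2 B B1 B2 k : R) :
  0 < k -> 0 < B -> P ^+ 2 + Q ^+ 2 = k * B ^+ 2 ->
  P * P1 + Q * Q1 = k * (B * B1) ->
  P1 ^+ 2 + P * P2 + Q1 ^+ 2 + Q * Q2 <= k * (B1 ^+ 2 + B * B2) ->
  P * P2 + Q * Q2 + (P * Q1 - Q * P1) ^+ 2 / (k * B ^+ 2) <= k * B * B2.
Proof.
move=> k0 B0 E0 E1 E2.
have D0 : 0 < k * B ^+ 2 by rewrite mulr_gt0 ?exprn_gt0.
suff -> : (P * Q1 - Q * P1) ^+ 2 / (k * B ^+ 2) = P1 ^+ 2 + Q1 ^+ 2 - k * B1 ^+ 2.
  by move: E2; rewrite mulrDr; lra.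
apply: (canLR (mulfK (lt0r_neq0 D0))).
have -> : (P1 ^+ 2 + Q1 ^+ 2 - k * B1 ^+ 2) * (k * B ^+ 2) =
  (P1 ^+ 2 + Q1 ^+ 2) * (k * B ^+ 2) - (k * (B * B1)) ^+ 2 by ring.
by rewrite -E1 -E0; ring.
Qed.

(** Completion of the square (Y - be D)^2 / D. *)
Lemma drift_absorb (R : realType) (be br Y D : R) : 0 < D -> `|be| <= br ->
  - (br ^+ 2 / 2 * D) <= - (be * Y) + Y ^+ 2 / D / 2.
Proof.
move=> D0 bb.
have -> : - (be * Y) + Y ^+ 2 / D / 2 = (Y - be * D) ^+ 2 / D / 2 - be ^+ 2 / 2 * D.
  by field; rewrite lt0r_neq0.
have : be ^+ 2 <= br ^+ 2.
  by rewrite -(real_normK (num_real be)) lerXn2r ?nnegrE// (le_trans _ bb).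
move=> h; have : 0 <= (Y - be * D) ^+ 2 / D / 2.
  by rewrite !divr_ge0 ?sqr_ge0 ?ltW.
have : be ^+ 2 * D <= br ^+ 2 * D by rewrite ler_wpM2r// ltW.
lra.
Qed.

(** If |W|, W = P + i Q, touches sqrt kp * B from below, then the real part of
    conj W times the equation of W bounds the operator applied to B from below.
    The drift splits into Re b0, which only meets the gradient of B by the
    first order condition, and Im b0, which only meets the rotation of the
    phase and is paid for by second_order_gain, at the price of n b^2 / 2.  Of
    this gain one half is used; the direction k has no more than that, as the
    test in the direction s takes the other half of the weight. *)
Lemma max_point_ineq (R : realType) (n : nat) (k : 'I_n)
    (cr ci c b P Q Pt Qt Ps Qs B Bt Bs Bss kp : R)
    (br bi P1 Q1 P2 Q2 B1 B2 : 'I_n -> R) :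
  0 < kp -> 0 < B -> P ^+ 2 + Q ^+ 2 = kp * B ^+ 2 ->
  `|cr| <= c -> (forall j, `|br j| <= b) -> (forall j, `|bi j| <= b) ->
  Pt + \sum_j P2 j = cr * P - ci * Q + \sum_j (br j * P1 j - bi j * Q1 j) ->
  Qt + \sum_j Q2 j = cr * Q + ci * P + \sum_j (br j * Q1 j + bi j * P1 j) ->
  P * Pt + Q * Qt <= kp * (B * Bt) ->
  (forall j, P * P1 j + Q * Q1 j = kp * (B * B1 j)) ->
  (forall j, P1 j ^+ 2 + P * P2 j + Q1 j ^+ 2 + Q * Q2 j
             <= kp * (B1 j ^+ 2 + B * B2 j)) ->
  P * Ps + Q * Qs = kp * (B * Bs) ->
  Ps ^+ 2 + P * P2 k + Qs ^+ 2 + Q * Q2 k <= kp * (Bs ^+ 2 + B * Bss) ->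
  0 <= Bt + \sum_j half_at R k j * B2 j + Bss / 2
       + b * \sum_j `|B1 j| + (c + n%:R * b ^+ 2 / 2) * B.
Proof.
move=> kp0 B0 E0 hc hbr hbi EP EQ Et E1 E2 Es Ess.
set D := kp * B ^+ 2 in E0.
have D0 : 0 < D by rewrite mulr_gt0 ?exprn_gt0.
pose Y j := P * Q1 j - Q * P1 j.
have kB0 : 0 < kp * B by rewrite mulr_gt0.
have Yj j : P * P2 j + Q * Q2 j + Y j ^+ 2 / D / 2
    <= kp * B * (half_at R k j * B2 j) + (if j == k then kp * B * (Bss / 2) else 0).
  have g1 := second_order_gain kp0 B0 E0 (E1 j) (E2 j).
  have Y0 : 0 <= Y j ^+ 2 / D by rewrite divr_ge0 ?sqr_ge0// ltW.
  rewrite /half_at; case: eqVneq => [jk|_]; last by rewrite -/D -/(Y j) in g1; lra.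
  subst j; have g2 := second_order_gain kp0 B0 E0 Es Ess.
  have Y1 : 0 <= (P * Qs - Q * Ps) ^+ 2 / (kp * B ^+ 2).
    by rewrite divr_ge0 ?sqr_ge0// ltW.
  by rewrite -/D -/(Y k) in g1; lra.
have hsum := ler_sum (index_enum 'I_n) (P := xpredT) (fun j _ => Yj j).
rewrite !big_split/= -big_mkcond/= big_pred1_eq -3!mulr_sumr in hsum.
(* drift and phase rotation, coordinate by coordinate *)
have hlow j : - (kp * B * (b * `|B1 j|)) - b ^+ 2 / 2 * D
    <= br j * (P * P1 j + Q * Q1 j) - bi j * Y j + Y j ^+ 2 / D / 2.
  have d1 := drift_absorb (Y j) D0 (hbi j).
  have d2 : - (kp * B * (b * `|B1 j|)) <= br j * (kp * (B * B1 j)).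
    have -> : br j * (kp * (B * B1 j)) = kp * B * (br j * B1 j) by ring.
    rewrite -mulrN ler_pM2l// lerNl (le_trans (ler_norm _))//.
    by rewrite normrN normrM ler_wpM2r.
  by rewrite E1; lra.
have hl := ler_sum (index_enum 'I_n) (P := xpredT) (fun j _ => hlow j).
rewrite !big_split/= !sumrN sumr_const card_ord -!mulr_sumr in hl.
have key : P * Pt + Q * Qt + P * \sum_j P2 j + Q * \sum_j Q2 j =
  cr * D + \sum_j br j * (P * P1 j + Q * Q1 j) - \sum_j bi j * Y j.

  have -> : P * Pt + Q * Qt + P * \sum_j P2 j + Q * \sum_j Q2 j =
    P * (Pt + \sum_j P2 j) + Q * (Qt + \sum_j Q2 j) by ring.
  rewrite EP EQ -E0 -[RHS]addrA.
  have -> : \sum_j br j * (P * P1 j + Q * Q1 j) - \sum_j bi j * Y j =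
    P * \sum_j (br j * P1 j - bi j * Q1 j) + Q * \sum_j (br j * Q1 j + bi j * P1 j).
    rewrite !mulr_sumr -sumrN -!big_split/=; apply: eq_bigr => j _; rewrite /Y; ring.
  ring.
have hcD : - (c * D) <= cr * D.
  by rewrite -mulNr ler_pM2r// lerNl (le_trans (ler_norm _))// normrN.
rewrite -(pmulr_rge0 _ kB0).
have DE : D = kp * B * B by rewrite /D; ring.
set S1 := \sum_j `|B1 j| in hl *; set SB := \sum_j half_at R k j * B2 j in hsum *.
have -> : kp * B * (Bt + SB + Bss / 2 + b * S1 + (c + n%:R * b ^+ 2 / 2) * B) =
  kp * (B * Bt) + kp * B * SB + kp * B * (Bss / 2) + kp * B * (b * S1)
  + c * D + n%:R * (b ^+ 2 / 2 * D) by rewrite DE; ring.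
rewrite -[_ *+ n]mulr_natl in hl.
move: key hsum hl hcD Et; clear; move: (\sum_j P2 j) (\sum_j Q2 j) => SP2 SQ2.
move: (\sum_j _ * (_ + _)) (\sum_j _ / _ / _) (\sum_j bi j * _) => ? ? ?; lra.
Qed.

(** * Exponential weights and strict supersolutions *)

Section oned.
Variable R : realType.
Implicit Types (f : R -> R) (x c d : R).

Lemma is_derive_mulc f x c d : is_derive x 1 f d ->
  is_derive x 1 (fun y => c * f y) (c * d).
Proof. by move=> fd; exact: (is_deriveZ c). Qed.

Lemma is_derive_mulcr f x c d : is_derive x 1 f d ->
  is_derive x 1 (fun y => f y * c) (d * c).
Proof.
move=> fd; rewrite (_ : (fun y => _) = fun y => c * f y).
  by rewrite mulrC; exact: is_derive_mulc.
by apply/funext => y; rewrite mulrC.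
Qed.

Lemma is_derive_add f g x d d' : is_derive x 1 f d -> is_derive x 1 g d' ->
  is_derive x 1 (fun y => f y + g y) (d + d').
Proof. by move=> fd gd; exact: is_deriveD. Qed.

Lemma is_derive_sub f g x d d' : is_derive x 1 f d -> is_derive x 1 g d' ->
  is_derive x 1 (fun y => f y - g y) (d - d').
Proof. by move=> fd gd; exact: is_deriveB. Qed.

Lemma is_derive_sq f x d : is_derive x 1 f d ->
  is_derive x 1 (fun y => f y ^+ 2) (2 * (f x * d)).
Proof.
move=> fd; rewrite (_ : (fun y => _) = f ^+ 2).
  by apply: is_derive_eq; rewrite scale_realE expr1 mulrA.
by apply/funext => z; rewrite exprfctE.
Qed.

Lemma is_derive_expl a b x :
  is_derive x 1 (fun y => expR (a * (b + y))) (a * expR (a * (b + x))).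
Proof.
have h : is_derive x 1 (fun y : R => a * (b + y)) a.
  rewrite -[X in is_derive _ _ _ X]mulr1; apply: is_derive_mulc.
  rewrite -[X in is_derive _ _ _ X]add0r.
  by apply: is_derive_add; exact: is_derive_id.
have := @is_derive1_comp _ (@expR R) _ x _ _ (is_derive_expR _) h.
by rewrite mulrC.
Qed.

Definition cosh2 x := expR x + expR (- x).
Definition sinh2 x := expR x - expR (- x).

Lemma is_derive_cosh2 a b x :
  is_derive x 1 (fun y => cosh2 (a * (b + y))) (a * sinh2 (a * (b + x))).
Proof.
rewrite /cosh2 /sinh2 mulrBr -mulNr; apply: is_derive_add; first exact: is_derive_expl.
by under eq_fun do rewrite -mulNr; rewrite -[- (a * (_ + _))]mulNr; exact: is_derive_expl.
Qed.

Lemma is_derive_sinh2 a b x :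
  is_derive x 1 (fun y => sinh2 (a * (b + y))) (a * cosh2 (a * (b + x))).
Proof.
rewrite /cosh2 /sinh2 mulrDr -[a * expR (- _)]opprK -mulNr.
apply: is_derive_sub; first exact: is_derive_expl.
by under eq_fun do rewrite -mulNr; rewrite -[- (a * (_ + _))]mulNr; exact: is_derive_expl.
Qed.

Lemma cosh2_gt0 x : 0 < cosh2 x.
Proof. by rewrite addr_gt0 ?expR_gt0. Qed.

Lemma sinh2_le_cosh2 x : `|sinh2 x| <= cosh2 x.
Proof. by rewrite ler_norml /sinh2 /cosh2; have := expR_gt0 x; have := expR_gt0 (- x); lra. Qed.

Lemma expR_norm_le_cosh2 x : expR `|x| <= cosh2 x.
Proof.
by rewrite /cosh2; have := expR_gt0 x; have := expR_gt0 (- x); case: (ger0P x); lra.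
Qed.

Lemma cosh2_le_expR_norm x : cosh2 x <= 2 * expR `|x|.
Proof.
have h1 : expR x <= expR `|x| by rewrite ler_expR ler_norm.
have h2 : expR (- x) <= expR `|x| by rewrite ler_expR -normrN ler_norm.
by rewrite /cosh2; lra.
Qed.

Lemma cosh2D_le x y : cosh2 (x + y) <= expR `|y| * cosh2 x.
Proof.
rewrite /cosh2 opprD !expRD mulrDr ![expR `|y| * _]mulrC.
by apply: lerD; rewrite ler_pM2l ?expR_gt0// ler_expR ?ler_norm// -normrN ler_norm.
Qed.

End oned.

Section weight.
Variables (R : realType) (n : nat).
Implicit Types (x : 'rV[R]_n) (l t s : R).

Definition unit_vec (j : 'I_n) : 'rV[R]_n := delta_mx 0 j.
Local Notation e_ := unit_vec.

Definition coshsum l x := \sum_(j < n) cosh2 (l * x 0 j).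

(** A smooth substitute for e^(l (|x| + t)) : its first logarithmic
    derivatives are at most l, and a shift by h in x costs at most e^(l h). *)
Definition weight l x t := expR (l * t) * coshsum l x.

Lemma coshsum_ge0 l x : 0 <= coshsum l x.
Proof. by apply: sumr_ge0 => j _; rewrite ltW ?cosh2_gt0. Qed.

Lemma coshsum_gt0 l x : (0 < n)%N -> 0 < coshsum l x.
Proof.
move=> n0; rewrite /coshsum (bigD1 (Ordinal n0))//= ltr_pwDl ?cosh2_gt0//.
by apply: sumr_ge0 => j _; rewrite ltW ?cosh2_gt0.
Qed.

Lemma coshsum_le l x rho : 0 <= l -> (forall j, `|x 0 j| <= rho) ->
  coshsum l x <= 2 * n%:R * expR (l * rho).
Proof.
move=> l0 xr; have -> : 2 * n%:R * expR (l * rho) = \sum_(j < n) 2 * expR (l * rho).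
  by rewrite sumr_const card_ord -mulr_natl; ring.
apply: ler_sum => j _; rewrite (le_trans (cosh2_le_expR_norm _))// ler_pM2l// ler_expR.
by rewrite normrM ger0_norm// ler_wpM2l.
Qed.

Lemma expR_le_coshsum l x i : 0 <= l -> expR (l * `|x 0 i|) <= coshsum l x.
Proof.
move=> l0; rewrite /coshsum (bigD1 i)//=; apply: ler_wpDr.
  by apply: sumr_ge0 => j _; rewrite ltW ?cosh2_gt0.
by rewrite (le_trans _ (expR_norm_le_cosh2 _))// normrM (ger0_norm l0).
Qed.
Lemma weight_ge0 l x t : 0 <= weight l x t.
Proof. by rewrite mulr_ge0 ?coshsum_ge0 ?expR_ge0. Qed.

Lemma weight_gt0 l x t : (0 < n)%N -> 0 < weight l x t.
Proof. by move=> ?; rewrite mulr_gt0 ?coshsum_gt0 ?expR_gt0. Qed.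

Lemma coshsum_shift l h x (v : 'rV[R]_n) : 0 <= l ->
  (forall j, `|v 0 j| <= h) -> coshsum l (x + v) <= expR (l * h) * coshsum l x.
Proof.
move=> l0 vh; rewrite /coshsum mulr_sumr; apply: ler_sum => j _.
rewrite mxE mulrDr (le_trans (cosh2D_le _ _))// ler_pM2r ?cosh2_gt0// ler_expR.
by rewrite normrM ger0_norm// ler_wpM2l.
Qed.

Lemma weight_shift l h x (v : 'rV[R]_n) t : 0 <= l ->
  (forall j, `|v 0 j| <= h) -> weight l (x + v) t <= expR (l * h) * weight l x t.
Proof.
by move=> l0 vh; rewrite /weight mulrCA ler_pM2l ?expR_gt0// coshsum_shift.
Qed.

Lemma is_derive_coshsum l (j : 'I_n) x (r : R) :
  is_derive r 1 (fun r => coshsum l (x + r *: e_ j))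
    (l * sinh2 (l * (x + r *: e_ j) 0 j)).
Proof.
have E q : coshsum l (x + q *: e_ j) =
    \sum_(i < n | i != j) cosh2 (l * x 0 i) + cosh2 (l * (x 0 j + q)).
  rewrite /coshsum (bigD1 j)//= addrC; congr (_ + _).
    apply: eq_bigr => i ij; rewrite !mxE (negbTE ij) eqxx /= mulr0 addr0//.
  by rewrite !mxE !eqxx mulr1.
rewrite (eq_fun E) !mxE !eqxx mulr1 -[X in is_derive _ _ _ X]add0r.
by apply: is_derive_add; exact: is_derive_cosh2.
Qed.

(** The derivatives are part of the data only to make the notion stable under
    sums (supersolD).  The inequality is the strict negation of the one which
    max_point_ineq imposes on a barrier. *)
Definition supersol (b K s0 : R) (k : 'I_n) (B : 'rV[R]_n -> R -> R -> R) :=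
  exists (Bt : 'rV[R]_n -> R -> R -> R) (B1 B2 : 'I_n -> 'rV[R]_n -> R -> R -> R)
    (Bs Bss : 'rV[R]_n -> R -> R -> R),
  [/\ forall x t s, is_derive t 1 (fun r => B x r s) (Bt x t s),
   forall j x t s (r : R),
     is_derive r 1 (fun r => B (x + r *: e_ j) t s) (B1 j (x + r *: e_ j) t s) /\
     is_derive r 1 (fun r => B1 j (x + r *: e_ j) t s) (B2 j (x + r *: e_ j) t s),
   forall x t s, is_derive s 1 (B x t) (Bs x t s) /\
                 is_derive s 1 (Bs x t) (Bss x t s)
  & forall x t s, 0 < s < s0 ->
    Bt x t s + \sum_j half_at R k j * B2 j x t s + Bss x t s / 2
    + b * \sum_j `|B1 j x t s| + K * B x t s < 0].

Lemma supersolD b K s0 k B B' : 0 <= b ->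
  supersol b K s0 k B -> supersol b K s0 k B' ->
  supersol b K s0 k (fun x t s => B x t s + B' x t s).
Proof.
move=> b0 [Bt [B1 [B2 [Bs [Bss [h1 h2 h3 h4]]]]]].
move=> [Ct [C1 [C2 [Cs [Css [g1 g2 g3 g4]]]]]].
exists (fun x t s => Bt x t s + Ct x t s), (fun j x t s => B1 j x t s + C1 j x t s),
  (fun j x t s => B2 j x t s + C2 j x t s), (fun x t s => Bs x t s + Cs x t s),
  (fun x t s => Bss x t s + Css x t s); split.
- by move=> x t s; exact: is_derive_add.
- by move=> j x t s r; have [? ?] := h2 j x t s r; have [? ?] := g2 j x t s r;
    split; exact: is_derive_add.
- by move=> x t s; have [? ?] := h3 x t s; have [? ?] := g3 x t s;
    split; exact: is_derive_add.
- move=> x t s ss; have := h4 x t s ss; have := g4 x t s ss.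
  have -> : \sum_j half_at R k j * (B2 j x t s + C2 j x t s) =
      \sum_j half_at R k j * B2 j x t s + \sum_j half_at R k j * C2 j x t s.
    by rewrite -big_split; apply: eq_bigr => j _; rewrite mulrDr.
  have : b * \sum_j `|B1 j x t s + C1 j x t s| <=
      b * (\sum_j `|B1 j x t s| + \sum_j `|C1 j x t s|).
    by rewrite ler_wpM2l// -big_split; apply: ler_sum => j _; exact: ler_normD.
  move: (\sum_j `|_ + _|) (\sum_j `|B1 _ _ _ _|) (\sum_j `|C1 _ _ _ _|).
  move: (\sum_j _ * B2 _ _ _ _) (\sum_j _ * C2 _ _ _ _) => ? ? ? ? ?; lra.
Qed.

(** Everything but the second derivative in s costs at most a constant factor
    l + l^2 + b l + K, so the profile g has to be concave enough to beat
    that factor. *)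
Lemma supersol_weight b K s0 k l (g g1 g2 : R -> R) : (0 < n)%N ->
  0 <= b -> 0 <= l ->
  (forall s, is_derive s 1 g (g1 s)) -> (forall s, is_derive s 1 g1 (g2 s)) ->
  (forall s, 0 < s < s0 -> 0 <= g s /\
    (l + l ^+ 2 + b * l + K) * g s + g2 s / 2 < 0) ->
  supersol b K s0 k (fun x t s => weight l x t * g s).
Proof.
move=> n0 b0 l0 dg dg1 hg.
exists (fun x t s => l * weight l x t * g s),
  (fun j x t s => expR (l * t) * (l * sinh2 (l * x 0 j)) * g s),
  (fun j x t s => expR (l * t) * (l * (l * cosh2 (l * x 0 j))) * g s),
  (fun x t s => weight l x t * g1 s), (fun x t s => weight l x t * g2 s); split.
- move=> x t s; rewrite /weight; apply: is_derive_mulcr; rewrite mulrA.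
  apply: is_derive_mulcr; have := is_derive_expl l 0 t.
  by under eq_fun do rewrite add0r; rewrite add0r.
- move=> j x t s r; split; apply/is_derive_mulcr/is_derive_mulc.
    exact: is_derive_coshsum.
  apply: is_derive_mulc; rewrite !mxE !eqxx mulr1.
  by under eq_fun do rewrite !mxE !eqxx mulr1; exact: is_derive_sinh2.
- by move=> x t s; split; exact: is_derive_mulc.
- move=> x t s /hg[gs0 hgs].
  have W0 := weight_gt0 l x t n0.
  have Wg : 0 <= weight l x t * g s by rewrite mulr_ge0// ltW.
  have S2 : \sum_j half_at R k j * (expR (l * t) * (l * (l * cosh2 (l * x 0 j))) * g s)
      <= l ^+ 2 * (weight l x t * g s).
    rewrite /weight /coshsum !mulr_sumr mulr_suml mulr_sumr; apply: ler_sum => j _.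
    have c0 : 0 <= expR (l * t) * cosh2 (l * x 0 j) * g s.
      by rewrite mulr_ge0// mulr_ge0 ?expR_ge0// ltW// cosh2_gt0.
    have -> : half_at R k j * (expR (l * t) * (l * (l * cosh2 (l * x 0 j))) * g s) =
      half_at R k j * (l ^+ 2 * (expR (l * t) * cosh2 (l * x 0 j) * g s)) by ring.
    apply: ler_piMl; first by rewrite mulr_ge0 ?sqr_ge0.
    by rewrite /half_at; case: ifP => _ //; rewrite invf_le1 ?ler1n ?ltr0n.
  have S1 : \sum_j `|expR (l * t) * (l * sinh2 (l * x 0 j)) * g s|
      <= l * (weight l x t * g s).
    rewrite /weight /coshsum !mulr_sumr mulr_suml mulr_sumr; apply: ler_sum => j _.
    rewrite !normrM (ger0_norm gs0) (ger0_norm l0) ger0_norm ?expR_ge0//.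
    have -> : expR (l * t) * (l * `|sinh2 (l * x 0 j)|) * g s =
      l * (expR (l * t) * `|sinh2 (l * x 0 j)| * g s) by ring.
    rewrite ler_wpM2l// ler_wpM2r// ler_wpM2l ?expR_ge0//; exact: sinh2_le_cosh2.
  have S1' := ler_wpM2l b0 S1.
  have : weight l x t * ((l + l ^+ 2 + b * l + K) * g s + g2 s / 2) < 0.
    by rewrite pmulr_rlt0.
  move: S2 S1'; clear S1; move: (\sum_j _) (b * \sum_j _) => A1 A2; lra.
Qed.

End weight.

(** * Solutions and their symmetric differences *)

Section cmod.
Variable R : realType.
Implicit Types z : R[i].

Lemma cmod_sqr z : cmod z ^+ 2 = complex.Re z ^+ 2 + complex.Im z ^+ 2.
Proof. by case: z => a b; rewrite /cmod /= sqr_sqrtr// addr_ge0 ?sqr_ge0. Qed.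

Lemma cmod_ge0 z : 0 <= cmod z.
Proof. by case: z => a b; rewrite /cmod /= sqrtr_ge0. Qed.

Lemma cmodD z z' : cmod (z + z') <= cmod z + cmod z'.
Proof. exact: le_normcD. Qed.

Lemma cmodN z : cmod (- z) = cmod z.
Proof. exact: normcN. Qed.

Lemma cmodB z z' : cmod (z - z') <= cmod z + cmod z'.
Proof. by rewrite -(cmodN z') cmodD. Qed.

Lemma cmod0 : cmod (0 : R[i]) = 0.
Proof. exact: Normc.normc0. Qed.

Lemma Re_le_cmod z : `|complex.Re z| <= cmod z.
Proof.
rewrite -(@ler_pXn2r _ 2)// ?nnegrE ?cmod_ge0// cmod_sqr real_normK ?num_real//.
by rewrite lerDl sqr_ge0.
Qed.

Lemma Im_le_cmod z : `|complex.Im z| <= cmod z.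
Proof.
rewrite -(@ler_pXn2r _ 2)// ?nnegrE ?cmod_ge0// cmod_sqr real_normK ?num_real//.
by rewrite lerDr sqr_ge0.
Qed.

Lemma cmod_le z : cmod z <= `|complex.Re z| + `|complex.Im z|.
Proof.
rewrite -(@ler_pXn2r _ 2)// ?nnegrE ?cmod_ge0 ?addr_ge0// cmod_sqr sqrrD.
by rewrite !real_normK ?num_real// addrAC lerDl mulrn_wge0// mulr_ge0.
Qed.

End cmod.

Section caloric.
Variables (R : realType) (n : nat).
Implicit Types (w : 'rV[R]_n -> R -> R[i]).
Local Notation e_ := (@unit_vec R n).

Definition cis_derive (f : R -> R[i]) (s : R) (d : R[i]) :=
  is_derive s 1 (fun r => complex.Re (f r)) (complex.Re d) /\
  is_derive s 1 (fun r => complex.Im (f r)) (complex.Im d).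

Lemma cis_deriveB f g s d d' : cis_derive f s d -> cis_derive g s d' ->
  cis_derive (fun r => f r - g r) s (d - d').
Proof.
move=> [f1 f2] [g1 g2]; split; rewrite raddfB/=; under eq_fun do rewrite raddfB/=;
  exact: is_derive_sub.
Qed.

Lemma cis_deriveN f s d : cis_derive f s d -> cis_derive (fun r => - f r) s (- d).
Proof.
by move=> [f1 f2]; split; rewrite raddfN/=; under eq_fun do rewrite raddfN/=;
  exact: is_deriveN.
Qed.

Lemma cis_derive_comp_opp f s d : cis_derive f (- s) d ->
  cis_derive (fun r => f (- r)) s (- d).
Proof.
have aux (h : R -> R) a : is_derive (- s) 1 h a -> is_derive s 1 (fun r => h (- r)) (- a).
  move=> ha; have := @is_derive1_comp _ h -%R s _ _ ha (is_deriveNid _ _).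
  by rewrite mulrN1.
by move=> [f1 f2]; split; rewrite raddfN/=; exact: aux.
Qed.

(** Solutions at positive times, with derivatives along coordinate lines, which
    is where the maximum principle tests them.  They are existential for the
    sake of caloric_increment. *)
Definition caloric (c0 : R[i]) (b0 : 'rV[R[i]]_n) w :=
  exists (wt : 'rV[R]_n -> R -> R[i]) (w1 w2 : 'I_n -> 'rV[R]_n -> R -> R[i]),
  [/\ forall p : 'rV[R]_n * R, 0 < p.2 ->
        {for p, continuous (fun q => complex.Re (w q.1 q.2))} /\
        {for p, continuous (fun q => complex.Im (w q.1 q.2))},
   forall x t, 0 < t -> cis_derive (w x) t (wt x t),
   forall j x s t, 0 < t ->
     cis_derive (fun r => w (x + r *: e_ j) t) s (w1 j (x + s *: e_ j) t) /\
     cis_derive (fun r => w1 j (x + r *: e_ j) t) s (w2 j (x + s *: e_ j) t)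
  & forall x t, 0 < t ->
     wt x t + \sum_j w2 j x t = c0 * w x t + \sum_j b0 0 j * w1 j x t].

(** Doubling of the variable x_k.  As a function of (x, t, s) it vanishes at
    s = 0, and its second derivatives in x_k and in s agree. *)
Definition sym_diff w (k : 'I_n) x t s := w (x + s *: e_ k) t - w (x - s *: e_ k) t.

Lemma csq_max_test (F F1 : R -> R[i]) (F2 : R[i]) (B B1 : R -> R) (B2 kp x r : R) :
  0 < r ->
  (forall s, `|s - x| < r -> cis_derive F s (F1 s)) -> cis_derive F1 x F2 ->
  (forall s, `|s - x| < r -> is_derive s 1 B (B1 s)) -> is_derive x 1 B1 B2 ->
  (forall s, `|s - x| < r -> cmod (F s) ^+ 2 <= kp * B s ^+ 2) ->
  cmod (F x) ^+ 2 = kp * B x ^+ 2 ->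
  complex.Re (F x) * complex.Re (F1 x) + complex.Im (F x) * complex.Im (F1 x) =
    kp * (B x * B1 x) /\
  complex.Re (F1 x) ^+ 2 + complex.Re (F x) * complex.Re F2 +
  complex.Im (F1 x) ^+ 2 + complex.Im (F x) * complex.Im F2
    <= kp * (B1 x ^+ 2 + B x * B2).
Proof.
move=> r0 dF [dF1 dF2] dB dB1 hmax hx.
apply: (@sq_max_test R (fun s => complex.Re (F s)) (fun s => complex.Im (F s)) B
  (fun s => complex.Re (F1 s)) (fun s => complex.Im (F1 s)) B1 _ _ _ _ x r) => //.
- by move=> s /dF[].
- by move=> s /dF[].
- by move=> s /hmax; rewrite -!cmod_sqr; lra.
Qed.

Lemma box_compact (rho d s0 : R) :
  compact (([set x : 'rV[R]_n | forall j, `[- rho, rho]%classic (x 0 j)]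
    `*` `[d, rho]%classic) `*` `[0, s0]%classic).
Proof.
apply: compact_setX; last exact: segment_compact.
apply: compact_setX; last exact: segment_compact.
by apply: (@rV_compact R n (fun=> `[- rho, rho]%classic)) => j; exact: segment_compact.
Qed.

Lemma sym_diff_continuous c0 b0 w k (p : 'rV[R]_n * R * R) :
  caloric c0 b0 w -> 0 < p.1.2 ->
  {for p, continuous (fun q => cmod (sym_diff w k q.1.1 q.1.2 q.2) ^+ 2)}.
Proof.
move=> [wt [w1 [w2 [cw _ _ _]]]] p0.
have sh (f : 'rV[R]_n * R -> R) (a : R) :
    {for (p.1.1 + (a * p.2) *: e_ k, p.1.2), continuous f} ->
    (fun q : 'rV[R]_n * R * R => f (q.1.1 + (a * q.2) *: e_ k, q.1.2)) @ p -->
    f (p.1.1 + (a * p.2) *: e_ k, p.1.2).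
  move=> cf; apply: (cvg_comp _ f _ cf).
  have h1 : (fun q : 'rV[R]_n * R * R => q.1.1 + (a * q.2) *: e_ k) @ p -->
      p.1.1 + (a * p.2) *: e_ k.
    apply: cvgD; first exact: (cvg_comp _ _ cvg_fst cvg_fst).
    by apply: cvgZr_tmp; apply: cvgMl_tmp; exact: cvg_snd.
  have h2 : (fun q : 'rV[R]_n * R * R => q.1.2) @ p --> p.1.2.
    exact: (cvg_comp _ _ cvg_fst cvg_snd).
  exact: (cvg_pair h1 h2).
have [R1 I1] := cw (p.1.1 + (1 * p.2) *: e_ k, p.1.2) p0.
have [R2 I2] := cw (p.1.1 + (-1 * p.2) *: e_ k, p.1.2) p0.
have E : (fun q : 'rV[R]_n * R * R => cmod (sym_diff w k q.1.1 q.1.2 q.2) ^+ 2) =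
  fun q => (complex.Re (w (q.1.1 + (1 * q.2) *: e_ k) q.1.2) -
            complex.Re (w (q.1.1 + (-1 * q.2) *: e_ k) q.1.2)) ^+ 2 +
           (complex.Im (w (q.1.1 + (1 * q.2) *: e_ k) q.1.2) -
            complex.Im (w (q.1.1 + (-1 * q.2) *: e_ k) q.1.2)) ^+ 2.
  by apply/funext => q; rewrite cmod_sqr /sym_diff !raddfB/= mul1r mulN1r scaleNr.
have X2 (f : 'rV[R]_n * R * R -> R) : {for p, continuous f} ->
    {for p, continuous (fun q => f q ^+ 2)}.
  by move=> cf; apply: (cvg_comp _ (fun y : R => y ^+ 2) cf); exact: exprn_continuous.
rewrite E; apply: cvgD; apply: X2; apply: cvgB.
- exact: (sh _ 1 R1).
- exact: (sh _ (-1) R2).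
- exact: (sh _ 1 I1).
- exact: (sh _ (-1) I2).
Qed.

End caloric.

(** * Maximum principle in a strip *)

Section maxprinciple.
Variables (R : realType) (n : nat) (c0 : R[i]) (b0 : 'rV[R[i]]_n).
Variables (w : 'rV[R]_n -> R -> R[i]) (c b d s0 : R) (k : 'I_n).
Variable B : 'rV[R]_n -> R -> R -> R.
Hypotheses (w_caloric : caloric c0 b0 w) (hc : cmod c0 <= c)
  (hb : forall j, cmod (b0 0 j) <= b) (d_gt0 : 0 < d).
Hypothesis B_super : supersol b (c + n%:R * b ^+ 2 / 2) s0 k B.
Hypothesis B_gt0 : forall x t s, 0 <= s <= s0 -> 0 < B x t s.
Hypothesis B_cont : continuous (fun p : 'rV[R]_n * R * R => B p.1.1 p.1.2 p.2).
Local Notation W := (sym_diff w k).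
Local Notation e_ := (@unit_vec R n).

(** At a touching point all the hypotheses of max_point_ineq hold, with the
    derivatives of W obtained from those of w at x + s e_k and x - s e_k. *)
Lemma no_interior_touch kp x t s : 0 < kp -> d <= t -> 0 < s < s0 ->
  (forall x' t' s', d <= t' -> 0 <= s' <= s0 ->
    cmod (W x' t' s') ^+ 2 <= kp * B x' t' s' ^+ 2) ->
  cmod (W x t s) ^+ 2 = kp * B x t s ^+ 2 -> False.
Proof.
move=> kp0 dt ss hmax hx.
have [Bt [B1 [B2 [Bs [Bss [hBt hB1 hBs hB]]]]]] := B_super.
have [wt [w1 [w2 [_ hwt hw1 hw]]]] := w_caloric.
have t0 : 0 < t by rewrite (lt_le_trans d_gt0).
have s_in : 0 <= s <= s0 by lra.
have := hB x t s ss; rewrite ltNge => /negP; apply.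
set W1 := fun j => w1 j (x + s *: e_ k) t - w1 j (x - s *: e_ k) t.
set W2 := fun j => w2 j (x + s *: e_ k) t - w2 j (x - s *: e_ k) t.
set Wt := wt (x + s *: e_ k) t - wt (x - s *: e_ k) t.
set Ws := w1 k (x + s *: e_ k) t + w1 k (x - s *: e_ k) t.
have pde : Wt + \sum_j W2 j = c0 * W x t s + \sum_j b0 0 j * W1 j.
  have sE (f g : 'I_n -> R[i]) : \sum_j (f j - g j) = \sum_j f j - \sum_j g j.
    by rewrite -sumrN -big_split.
  have -> : \sum_j b0 0 j * W1 j = \sum_j b0 0 j * w1 j (x + s *: e_ k) t -
      \sum_j b0 0 j * w1 j (x - s *: e_ k) t.
    by rewrite -sE; apply: eq_bigr => j _; rewrite mulrBr.
  rewrite /Wt sE /W /sym_diff mulrBr addrACA -opprD hw// hw//.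
  by rewrite opprD addrACA.
have ReM (a z : R[i]) : complex.Re (a * z) =
  complex.Re a * complex.Re z - complex.Im a * complex.Im z by case: a; case: z.
have ImM (a z : R[i]) : complex.Im (a * z) =
  complex.Re a * complex.Im z + complex.Im a * complex.Re z by case: a; case: z.
have dir j : complex.Re (W x t s) * complex.Re (W1 j) +
    complex.Im (W x t s) * complex.Im (W1 j) = kp * (B x t s * B1 j x t s) /\
  complex.Re (W1 j) ^+ 2 + complex.Re (W x t s) * complex.Re (W2 j) +
  complex.Im (W1 j) ^+ 2 + complex.Im (W x t s) * complex.Im (W2 j)
    <= kp * (B1 j x t s ^+ 2 + B x t s * B2 j x t s).
  have ac (r a : R) : x + r *: e_ j + a *: e_ k = (x + a *: e_ k) + r *: e_ j.
    by rewrite addrAC.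
  have := @csq_max_test R (fun r => W (x + r *: e_ j) t s)
    (fun r => w1 j ((x + s *: e_ k) + r *: e_ j) t - w1 j ((x - s *: e_ k) + r *: e_ j) t)
    (W2 j) (fun r => B (x + r *: e_ j) t s) (fun r => B1 j (x + r *: e_ j) t s)
    (B2 j x t s) kp 0 1 ltr01.
  rewrite !scale0r !addr0; apply.
  - move=> r _; rewrite /sym_diff.
    under [X in cis_derive X]eq_fun do rewrite -scaleNr !ac scaleNr.
    by apply: cis_deriveB; apply: (hw1 _ _ _ _ t0).1.
  - rewrite /W2; apply: cis_deriveB.
      by have := (hw1 j (x + s *: e_ k) 0 t t0).2; rewrite scale0r addr0.
    by have := (hw1 j (x - s *: e_ k) 0 t t0).2; rewrite scale0r addr0.
  - by move=> r _; have [] := hB1 j x t s r.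
  - by have [_] := hB1 j x t s 0; rewrite scale0r addr0.
  - by move=> r _; exact: hmax.
  - exact: hx.
(* in the direction s the first derivatives at the two ends add up, while the
   second ones are subtracted, as in the direction k *)
have dirs : complex.Re (W x t s) * complex.Re Ws +
    complex.Im (W x t s) * complex.Im Ws = kp * (B x t s * Bs x t s) /\
  complex.Re Ws ^+ 2 + complex.Re (W x t s) * complex.Re (W2 k) +
  complex.Im Ws ^+ 2 + complex.Im (W x t s) * complex.Im (W2 k)
    <= kp * (Bs x t s ^+ 2 + B x t s * Bss x t s).
  have r0 : 0 < Num.min s (s0 - s) by rewrite lt_min; lra.
  have := @csq_max_test R (fun r => W x t r)
    (fun r => w1 k (x + r *: e_ k) t - - w1 k (x - r *: e_ k) t)
    (W2 k) (fun r => B x t r) (fun r => Bs x t r)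
    (Bss x t s) kp s _ r0.
  rewrite opprK; apply.
  - move=> r _; apply: cis_deriveB; first exact: (hw1 _ _ _ _ t0).1.
    have := (hw1 k x (- r) t t0).1 => /cis_derive_comp_opp.
    by under [X in cis_derive X]eq_fun do rewrite scaleNr; rewrite scaleNr.
  - apply: cis_deriveB; first exact: (hw1 _ _ _ _ t0).2.
    have := (hw1 k x (- s) t t0).2 => /cis_derive_comp_opp/cis_deriveN.
    by rewrite opprK; under [X in cis_derive X]eq_fun do rewrite scaleNr; rewrite scaleNr.
  - by move=> r _; have [] := hBs x t r.
  - by have [_] := hBs x t s.
  - move=> r; rewrite lt_min => /andP[h1 h2]; apply: hmax => //.
    by move: h1 h2; rewrite !ltr_norml; lra.
  - exact: hx.
have dirt : complex.Re (W x t s) * complex.Re Wt +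
    complex.Im (W x t s) * complex.Im Wt <= kp * (B x t s * Bt x t s).
  have dW : cis_derive (fun r => W x r s) t Wt by apply: cis_deriveB; exact: hwt.
  pose f r := complex.Re (W x r s) ^+ 2 + complex.Im (W x r s) ^+ 2 - kp * B x r s ^+ 2.
  have df : is_derive t 1 f (2 * (complex.Re (W x t s) * complex.Re Wt) +
      2 * (complex.Im (W x t s) * complex.Im Wt) - kp * (2 * (B x t s * Bt x t s))).
    apply: is_derive_sub; last by apply: is_derive_mulc; exact: is_derive_sq.
    by apply: is_derive_add; apply: is_derive_sq; have [] := dW.
  have := right_max_derive_le0 ltr01 df => /(_ _)/wrap[r /andP[r0 _]|].
    rewrite /f -!cmod_sqr hx subrr subr_le0; apply: hmax => //; lra.
  lra.
clearbody W1 W2 Wt Ws.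
have Re_pde := congr1 (@complex.Re R) pde; have Im_pde := congr1 (@complex.Im R) pde.
rewrite !raddfD !raddf_sum/= ReM in Re_pde; rewrite !raddfD !raddf_sum/= ImM in Im_pde.
apply: (@max_point_ineq R n k (complex.Re c0) (complex.Im c0) c b
  (complex.Re (W x t s)) (complex.Im (W x t s)) (complex.Re Wt) (complex.Im Wt)
  (complex.Re Ws) (complex.Im Ws) _ _ (Bs x t s) _ kp
  (fun j => complex.Re (b0 0 j)) (fun j => complex.Im (b0 0 j))
  (fun j => complex.Re (W1 j)) (fun j => complex.Im (W1 j))
  (fun j => complex.Re (W2 j)) (fun j => complex.Im (W2 j))).
- by [].
- exact: B_gt0.
- by rewrite -cmod_sqr.
- exact: le_trans (Re_le_cmod _) hc.
- by move=> j; exact: le_trans (Re_le_cmod _) (hb j).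
- by move=> j; exact: le_trans (Im_le_cmod _) (hb j).
- by rewrite Re_pde; congr (_ + _); apply: eq_bigr => j _; rewrite ReM.
- by rewrite Im_pde; congr (_ + _); apply: eq_bigr => j _; rewrite ImM.
- exact: dirt.
- by move=> j; have [] := dir j.
- by move=> j; have [] := dir j.
- by have [] := dirs.
- by have [] := dirs.
Qed.

(** On a compact part of the strip |W|^2 / B^2 has a maximum.  Elsewhere this
    quotient is at most 1, so if the maximum kp is larger than 1, the function
    sqrt kp * B touches |W| from above in the whole strip, at a point that is
    not on the lateral boundary: this is excluded by no_interior_touch. *)
Lemma sym_diff_le_supersol rho :
  (forall x t, d <= t -> cmod (W x t s0) <= B x t s0) ->
  (forall (x : 'rV[R]_n) (t s : R), d <= t -> 0 <= s <= s0 ->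
    (rho < t) \/ (exists j, rho < `|x 0 j|) -> cmod (W x t s) <= B x t s) ->
  forall x t s, d <= t -> 0 <= s <= s0 -> cmod (W x t s) <= B x t s.
Proof.
move=> hlat hout x0 t0 s1 dt0 s1in; rewrite leNgt; apply/negP => Wgt.
pose A := (([set x : 'rV[R]_n | forall j, `[- rho, rho]%classic (x 0 j)]
    `*` `[d, rho]%classic) `*` `[0, s0]%classic).
have inA x t s : d <= t -> 0 <= s <= s0 -> B x t s < cmod (W x t s) -> A (x, t, s).
  move=> dt ss Wlt; apply: contrapT => nA; move: Wlt; rewrite ltNge => /negP; apply.
  apply: hout => //; have [rt|tr] := ltP rho t; [by left|right].
  apply: contrapT => nx; apply: nA; split => /=; last by rewrite in_itv.
  split => /=; last by rewrite in_itv/= dt.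
  move=> j; rewrite /= in_itv/= -ler_norml leNgt; apply/negP => h.
  by apply: nx; exists j.
pose r (q : 'rV[R]_n * R * R) := cmod (W q.1.1 q.1.2 q.2) ^+ 2 / B q.1.1 q.1.2 q.2 ^+ 2.
have A_pos q : A q -> 0 < q.1.2 /\ 0 <= q.2 <= s0.
  case: q => [[x t] s] [[_ /=]]; rewrite !in_itv/= => /andP[dt _] ss; split => //.
  exact: lt_le_trans d_gt0 dt.
have rc : {within A, continuous r}.
  apply: continuous_in_subspaceT => q; rewrite inE => /A_pos[t0' ss].
  have B0 := B_gt0 q.1.1 q.1.2 ss.
  have c1 := @sym_diff_continuous R n c0 b0 w k q w_caloric t0'.
  have c2 : (fun q : 'rV[R]_n * R * R => (B q.1.1 q.1.2 q.2 ^+ 2)^-1) @ q -->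
      (B q.1.1 q.1.2 q.2 ^+ 2)^-1.
    apply: cvgV; first by rewrite expf_neq0// lt0r_neq0.
    have c3 : (fun q : 'rV[R]_n * R * R => B q.1.1 q.1.2 q.2) @ q -->
      B q.1.1 q.1.2 q.2 by exact: B_cont.
    by apply: (cvg_comp _ (fun y : R => y ^+ 2) c3); exact: exprn_continuous.
  exact: (cvgM c1 c2).
have A0 : A !=set0 by exists (x0, t0, s1); exact: inA.
have [p pA pmax] := compact_EVT_max A0 (@box_compact R n rho d s0) rc.
move: pA; rewrite inE => pA.
have [pt ps] := A_pos _ pA.
have Bp := B_gt0 p.1.1 p.1.2 ps.
have rE x t s : 0 <= s <= s0 -> forall z : R,
    (cmod (W x t s) ^+ 2 / B x t s ^+ 2 <= z) = (cmod (W x t s) ^+ 2 <= z * B x t s ^+ 2).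
  by move=> ss z; rewrite ler_pdivrMr// exprn_gt0// B_gt0.
have r1 : 1 < r p.
  apply: (@lt_le_trans _ _ (r (x0, t0, s1))); last by apply: pmax; rewrite inE; exact: inA.
  have B0 := B_gt0 x0 t0 s1in.
  by rewrite /r /= ltr_pdivlMr ?exprn_gt0// mul1r ltrXn2r ?nnegrE ?ltW ?cmod_ge0.
have r0 : 0 < r p by rewrite (lt_trans _ r1).
have small x t s : 0 <= s <= s0 -> cmod (W x t s) <= B x t s ->
    cmod (W x t s) ^+ 2 / B x t s ^+ 2 <= 1.
  by move=> ss h; rewrite rE// mul1r lerXn2r ?nnegrE ?cmod_ge0// ltW// B_gt0.
apply: (@no_interior_touch (r p) p.1.1 p.1.2 p.2) => //.
- by case: p pA {pmax pt ps Bp r1 r0} => [[x t] s] [[_ /=]]; rewrite !in_itv/= => /andP[].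
- have dp : d <= p.1.2.
    by case: p pA {pmax pt ps Bp r1 r0} => [[x t] s] [[_ /=]]; rewrite !in_itv/= => /andP[].
  rewrite !lt_neqAle; have /andP[-> ->] := ps; rewrite !andbT.
  apply/andP; split; apply/eqP => pE.
    move: r0; rewrite /r -pE /sym_diff !scale0r subr0 addr0 subrr cmod0.
    by rewrite expr0n/= mul0r ltxx.
  by move: r1; rewrite ltNge small// pE hlat.
- move=> x t s dt ss; rewrite -rE//.
  have [Wle|Wlt] := leP (cmod (W x t s)) (B x t s).
    by rewrite (le_trans (small _ _ _ ss Wle))// ltW.
  by apply: (pmax (x, t, s)); rewrite inE; exact: inA.
- by rewrite /r divfK// expf_neq0// lt0r_neq0.
Qed.

End maxprinciple.

(** * Lipschitz bound for symmetric differences *)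

Section lipschitz.
Variables (R : realType) (n : nat).
Local Notation e_ := (@unit_vec R n).

Lemma weight_continuous l (g : R -> R) : continuous g ->
  continuous (fun p : 'rV[R]_n * R * R => weight l p.1.1 p.1.2 * g p.2).
Proof.
move=> cg p.
have c1 : (fun q : 'rV[R]_n * R * R => expR (l * q.1.2)) @ p --> expR (l * p.1.2).
  apply: (cvg_comp (fun q : 'rV[R]_n * R * R => l * q.1.2) expR); last exact: continuous_expR.
  by apply: cvgMl_tmp; exact: (cvg_comp _ _ cvg_fst cvg_snd).
have c2 : (fun q : 'rV[R]_n * R * R => coshsum l q.1.1) @ p --> coshsum l p.1.1.
  rewrite /coshsum; apply: cvg_big => [|j _]; first exact: add_continuous.
  have cj : (fun q : 'rV[R]_n * R * R => l * q.1.1 0 j) @ p --> l * p.1.1 0 j.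
    apply: cvgMl_tmp; apply: (cvg_comp (fun q : 'rV[R]_n * R * R => q.1.1) (fun x : 'rV[R]_n => x 0 j)).
      exact: (cvg_comp _ _ cvg_fst cvg_fst).
    exact: coord_continuous.
  apply: cvgD; apply: (cvg_comp _ expR); try exact: continuous_expR; first exact: cj.
  exact: (cvgN cj).
have c3 : (fun q : 'rV[R]_n * R * R => g q.2) @ p --> g p.2.
  by apply: (cvg_comp _ g); [exact: cvg_snd|exact: cg].
exact: (cvgM (cvgM c1 c2) c3).
Qed.

(** A larger rate wins at infinity, in space and time: a small multiple of
    weight (l + 1) is enough to compactify the comparison. *)
Lemma weight_decay l (x : 'rV[R]_n) t rho : 0 <= l -> (0 < n)%N -> 0 <= t ->
  (rho < t) \/ (exists j, rho < `|x 0 j|) ->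
  weight l x t <= 2 * n%:R * expR (- rho) * weight (l + 1) x t.
Proof.
move=> l0 n0 t0 h.
have [i _ imax] := @arg_maxP _ _ _ (Ordinal n0) xpredT (fun j => `|x 0 j|) isT.
have rx : rho <= t + `|x 0 i|.
  case: h => [h|[j h]]; first by rewrite (le_trans (ltW h))// lerDl.
  by rewrite (le_trans (ltW h))// (le_trans (imax j isT))// lerDr.
have S1 : coshsum l x <= 2 * n%:R * expR (l * `|x 0 i|) by apply: coshsum_le => // j; exact: imax.
have S2 : expR ((l + 1) * `|x 0 i|) <= coshsum (l + 1) x.
  by apply: expR_le_coshsum; rewrite addr_ge0.
rewrite /weight.
apply: (@le_trans _ _ (expR (l * t) * (2 * n%:R * expR (l * `|x 0 i|)))).
  by rewrite ler_pM2l ?expR_gt0.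
apply: (@le_trans _ _ (2 * n%:R * expR (- rho) *
    (expR ((l + 1) * t) * expR ((l + 1) * `|x 0 i|)))).
  rewrite mulrCA -[X in _ <= X]mulrA ler_wpM2l ?mulr_ge0// -!expRD ler_expR; lra.
by rewrite ler_wpM2l ?mulr_ge0 ?expR_ge0// ler_wpM2l ?expR_ge0.
Qed.

Lemma sym_diff_le w l M k (x : 'rV[R]_n) t s : 0 <= l -> 0 <= M -> 0 <= s ->
  (forall x t, 0 < t -> cmod (w x t) <= M * weight l x t) -> 0 < t ->
  cmod (sym_diff w k x t s) <= 2 * M * expR (l * s) * weight l x t.
Proof.
move=> l0 M0 s0 wM t0; rewrite /sym_diff (le_trans (cmodB _ _))//.
have h (a : R) : `|a| = s -> cmod (w (x + a *: e_ k) t) <= M * (expR (l * s) * weight l x t).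
  move=> as_; rewrite (le_trans (wM _ _ t0))// ler_wpM2l// weight_shift// => j.
  rewrite !mxE eqxx/=; case: eqVneq => _; first by rewrite mulr1 as_.
  by rewrite mulr0 normr0.
have := h s (ger0_norm s0); have := h (- s); rewrite normrN scaleNr => /(_ (ger0_norm s0)).
lra.
Qed.

Lemma is_derive_quad (a b0 b1 s : R) :
  is_derive s 1 (fun s => a * (b0 + 2 * s * b1 - s ^+ 2)) (a * (2 * b1 - 2 * s)).
Proof.
apply: is_derive_mulc; apply: is_derive_sub.
  rewrite -[X in is_derive _ _ _ X]add0r; apply: is_derive_add.
  apply: is_derive_mulcr; rewrite -[X in is_derive _ _ _ X]mulr1.
  exact: is_derive_mulc.
by rewrite -[in X in is_derive _ _ _ X](mulr1 s); exact: is_derive_sq.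
Qed.

Lemma is_derive_lin (a b1 s : R) :
  is_derive s 1 (fun s => a * (2 * b1 - 2 * s)) (a * (- 2)).
Proof.
apply: is_derive_mulc; rewrite -[X in is_derive _ _ _ X]add0r.
apply: is_derive_add; rewrite -[X in is_derive _ _ _ (- X)]mulr1.
by apply: is_deriveN; exact: is_derive_mulc.
Qed.

Lemma quad_continuous (a b0 b1 : R) :
  continuous (fun s : R => a * (b0 + 2 * s * b1 - s ^+ 2)).
Proof.
move=> s; apply: differentiable_continuous; apply/derivable1_diffP.
exact: (ex_derive (is_derive := is_derive_quad a b0 b1 s)).
Qed.

(** Barrier: weight l times a multiple of 2 s s0 - s^2, which is linear near
    s = 0 and dominates |W| at s = s0, plus eps times weight (l + 1) times a
    multiple of 2 s0^2 - s^2, which dominates |W| at infinity.  Both parabolas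
    have second derivative -2 and are at most 2 s0^2, hence are steep enough
    for supersol_weight when s0 is small.  The second part disappears as eps
    tends to 0. *)
Lemma sym_diff_lipschitz (c b l s0 M : R) (c0 : R[i]) (b0 : 'rV[R[i]]_n)
    (w : 'rV[R]_n -> R -> R[i]) (k : 'I_n) :
  (0 < n)%N -> 0 <= b -> 0 <= l -> 0 < s0 -> 0 < M ->
  ((l + 1) + (l + 1) ^+ 2 + b * (l + 1) + (c + n%:R * b ^+ 2 / 2)) * s0 ^+ 2 * 2 < 1 ->
  0 <= c -> cmod c0 <= c -> (forall j, cmod (b0 0 j) <= b) -> caloric c0 b0 w ->
  (forall x t, 0 < t -> cmod (w x t) <= M * weight l x t) ->
  forall x t s, 0 < t -> 0 <= s <= s0 ->
    cmod (sym_diff w k x t s) <= 4 * M * expR (l * s0) / s0 * s * weight l x t.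
Proof.
move=> n0 b_ge0 l0 s0_gt0 M0 Ls c_ge0 hc hb wc wM x t s t0 ss.
set K0 := c + _ in Ls; set L := (_ + _ + _ + K0) in Ls.
have bl0 : 0 <= b * l by rewrite mulr_ge0.
have K0_ge0 : 0 <= K0 by rewrite addr_ge0// divr_ge0// mulr_ge0// sqr_ge0.
have L0 : 0 < L by rewrite /L; have := sqr_ge0 (l + 1); nra.
pose L1 := l + l ^+ 2 + b * l + K0.
have L10 : 0 <= L1 by rewrite /L1; have := sqr_ge0 l; lra.
have L1L : L1 <= L by rewrite /L1 /L; nra.
have ss0 : 0 < s0 ^+ 2 by rewrite exprn_gt0.
pose M2 := 2 * M * expR (l * s0).
have M20 : 0 < M2 by rewrite !mulr_gt0 ?expR_gt0.
pose a1 := M2 / s0 ^+ 2.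
have a10 : 0 < a1 by rewrite divr_gt0.
have main eps : 0 < eps ->
    cmod (sym_diff w k x t s) <= 4 * M * expR (l * s0) / s0 * s * weight l x t +
      2 * eps * weight (l + 1) x t.
  move=> e0; pose a2 := eps / s0 ^+ 2.
  have a20 : 0 < a2 by rewrite divr_gt0.
  pose g1 s := a1 * (0 + 2 * s * s0 - s ^+ 2).
  pose g2 s := a2 * (2 * s0 ^+ 2 + 2 * s * 0 - s ^+ 2).
  pose B (x : 'rV[R]_n) t s := weight l x t * g1 s + weight (l + 1) x t * g2 s.
  have g1_ge0 r : 0 <= r <= s0 -> 0 <= g1 r.
    move=> /andP[r0 rs]; apply: mulr_ge0; first exact: ltW.
    have : 0 <= r * (s0 - r) by rewrite mulr_ge0 ?subr_ge0.
    have : 0 <= r * s0 by rewrite mulr_ge0// ltW.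
    lra.
  have g2_ge r : 0 <= r <= s0 -> eps <= g2 r.
    move=> /andP[r0 rs]; rewrite /g2 /a2 mulrAC ler_pdivlMr// ler_pM2l//.
    have : r ^+ 2 <= s0 ^+ 2 by rewrite lerXn2r// nnegrE ltW.
    lra.
  have B_super : supersol b K0 s0 k B.
    apply: supersolD => //.
      apply: (@supersol_weight _ _ _ _ _ k l g1 (fun s => a1 * (2 * s0 - 2 * s))
        (fun=> a1 * - 2)) => //.
    - by move=> r; exact: is_derive_quad.
    - by move=> r; exact: is_derive_lin.
    - move=> r rs; split; first by apply: g1_ge0; lra.
      have : 2 * r * s0 - r ^+ 2 <= s0 ^+ 2 by have := sqr_ge0 (s0 - r); rewrite sqrrB; lra.
      move=> h; rewrite -/L1.
      have -> : L1 * g1 r + a1 * -2 / 2 = a1 * (L1 * (2 * r * s0 - r ^+ 2) - 1).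
        by rewrite /g1; field.
      rewrite pmulr_rlt0//.
      have := ler_wpM2l L10 h; have : L1 * s0 ^+ 2 <= L * s0 ^+ 2 by rewrite ler_pM2r.
      move: Ls; nra.
    - apply: (@supersol_weight _ _ _ _ _ k (l + 1) g2 (fun s => a2 * (2 * 0 - 2 * s))
        (fun=> a2 * - 2)) => //; first by lra.
    - by move=> r; exact: is_derive_quad.
    - by move=> r; exact: is_derive_lin.
    - move=> r rs; split; first by rewrite (le_trans (ltW e0))// g2_ge//; lra.
      rewrite -/L.
      have -> : L * g2 r + a2 * -2 / 2 = a2 * (L * (2 * s0 ^+ 2 - r ^+ 2) - 1).
        by rewrite /g2; field.
      rewrite pmulr_rlt0//.
      have : L * (2 * s0 ^+ 2 - r ^+ 2) <= L * (2 * s0 ^+ 2).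
        by rewrite ler_pM2l// gerBl sqr_ge0.
      move: Ls; lra.
  have B_gt0 (y : 'rV[R]_n) r q : 0 <= q <= s0 -> 0 < B y r q.
    move=> qs; rewrite ltr_wpDl//; first by rewrite mulr_ge0 ?weight_ge0// g1_ge0.
    by rewrite mulr_gt0 ?weight_gt0// (lt_le_trans e0)// g2_ge.
  have B_cont : continuous (fun p : 'rV[R]_n * R * R => B p.1.1 p.1.2 p.2).
    by move=> p; apply: cvgD; apply: weight_continuous; exact: quad_continuous.
  pose rho := M2 * (2 * n%:R) / eps.
  have WM2 (y : 'rV[R]_n) r q : 0 < r -> 0 <= q <= s0 ->
      cmod (sym_diff w k y r q) <= M2 * weight l y r.
    move=> r0 /andP[q0 qs]; rewrite (le_trans (sym_diff_le k y l0 (ltW M0) q0 wM r0))//.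
    rewrite ler_wpM2r ?weight_ge0// /M2 ler_pM2l ?mulr_gt0//.
    by rewrite ler_expR ler_wpM2l.
  have := @sym_diff_le_supersol R n c0 b0 w c b t s0 k B wc hc hb t0 B_super B_gt0
    B_cont rho.
  move=> /(_ _ _ x t s (lexx _) ss)/wrap[y r tr|y r q tr qs|].
  - have r0 := lt_le_trans t0 tr.
    rewrite (le_trans (WM2 y r s0 r0 _))//; first by rewrite lexx ltW.
    have -> : B y r s0 = M2 * weight l y r + weight (l + 1) y r * g2 s0.
      by rewrite /B /g1 /a1; congr (_ + _); field; rewrite lt0r_neq0.
    rewrite lerDl mulr_ge0 ?weight_ge0// (le_trans (ltW e0))// g2_ge// lexx andbT ltW//.
  - move=> far; have r0 := lt_le_trans t0 tr.
    rewrite (le_trans (WM2 y r q r0 qs))//.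
    apply: (@le_trans _ _ (eps * weight (l + 1) y r)).
      rewrite (le_trans (ler_wpM2l (ltW M20) (weight_decay l0 n0 (ltW r0) far)))//.
      rewrite mulrA ler_wpM2r ?weight_ge0// mulrA expRN ler_pdivrMr ?expR_gt0//.
      rewrite [eps * _]mulrC -ler_pdivrMr// -/rho.
      by have := expR_ge1Dx rho; lra.
    rewrite /B [eps * _]mulrC; apply: ler_wpDl.
      by rewrite mulr_ge0 ?weight_ge0 ?g1_ge0.
    by rewrite ler_wpM2l ?weight_ge0// g2_ge.
  - move=> h; apply: (le_trans h); rewrite /B; apply: lerD.
      rewrite mulrC ler_wpM2r ?weight_ge0// /g1 /a1 /M2.
      have -> : 4 * M * expR (l * s0) / s0 * s =
        2 * M * expR (l * s0) / s0 ^+ 2 * (2 * s * s0).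
        by field; rewrite lt0r_neq0.
      by rewrite -/M2 -/a1 ler_pM2l// add0r gerBl sqr_ge0.
    rewrite mulrC ler_wpM2r ?weight_ge0// /g2 mulr0 addr0.
    have -> : 2 * eps = a2 * (2 * s0 ^+ 2) by rewrite /a2; field; rewrite lt0r_neq0.
    by rewrite ler_pM2l// gerBl sqr_ge0.
apply/ler_addgt0Pr => e e0.
have W0 := @weight_gt0 R n (l + 1) x t n0.
have ew : 0 < e / (2 * weight (l + 1) x t) by apply: divr_gt0 => //; exact: mulr_gt0.
apply: (le_trans (main _ ew)); rewrite lerD2l.
suff -> : 2 * (e / (2 * weight (l + 1) x t)) * weight (l + 1) x t = e by [].
by field; rewrite lt0r_neq0.
Qed.

End lipschitz.

(** * Iterated increments *)

Section iterate.
Variables (R : realType) (n : nat).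
Local Notation e_ := (@unit_vec R n).
Implicit Types (w : 'rV[R]_n -> R -> R[i]) (x v : 'rV[R]_n) (t : R).

Definition weight_bound (l M : R) w :=
  forall x t, 0 < t -> cmod (w x t) <= M * weight l x t.

(** Short increments are symmetric differences about the midpoint.  For those
    longer than 2 s0 the bound on w itself is enough. *)
Lemma coord_lipschitz (c b l : R) : (0 < n)%N -> 0 <= c -> 0 <= b -> 0 <= l ->
  exists2 A : R, 0 < A & forall (c0 : R[i]) (b0 : 'rV[R[i]]_n) w M,
    cmod c0 <= c -> (forall j, cmod (b0 0 j) <= b) -> caloric c0 b0 w -> 0 < M ->
    weight_bound l M w ->
    forall k x t h, 0 < t -> `|h| <= 1 ->
    cmod (w (x + h *: e_ k) t - w x t) <= A * `|h| * M * weight l x t.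
Proof.
move=> n0 c_ge0 b_ge0 l0.
pose L := (l + 1) + (l + 1) ^+ 2 + b * (l + 1) + (c + n%:R * b ^+ 2 / 2).
have L1 : 1 <= L.
  have : 0 <= b * (l + 1) by rewrite mulr_ge0 ?addr_ge0.
  have : 0 <= n%:R * b ^+ 2 / 2 by rewrite divr_ge0// mulr_ge0// sqr_ge0.
  have := sqr_ge0 (l + 1); rewrite /L; lra.
have L0 : 0 < L by lra.
pose s0 := (2 * L)^-1.
have s00 : 0 < s0 by rewrite invr_gt0 mulr_gt0.
have s0le : s0 <= 2^-1 by rewrite /s0 lef_pV2 ?posrE ?mulr_gt0//; lra.
have Ls0 : L * s0 ^+ 2 * 2 < 1.
  have -> : L * s0 ^+ 2 * 2 = s0 by rewrite /s0; field; rewrite lt0r_neq0.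
  by lra.
clearbody s0; have s0' : 0 <= s0 by exact: ltW.
exists (2 * expR l / s0); first by rewrite divr_gt0 ?mulr_gt0 ?expR_gt0.
move=> c0 b0 w M hc hb wc M0 wM k x t h t0 h1; have M0' := ltW M0.
have E0 := weight_ge0 l x t.
have coordE (a : R) j : `|(a *: e_ k) 0 j| <= `|a|.
  rewrite !mxE eqxx/=; case: eqVneq => _; first by rewrite mulr1.
  by rewrite mulr0 normr0.
have [hs|hs] := leP (`|h| / 2) s0.
  have W y : cmod (sym_diff w k y t (`|h| / 2)) <=
      4 * M * expR (l * s0) / s0 * (`|h| / 2) * weight l y t.
    apply: (sym_diff_lipschitz k n0 b_ge0 l0 s00 M0 Ls0 c_ge0 hc hb wc wM) => //.
    by rewrite hs divr_ge0.
  have -> : cmod (w (x + h *: e_ k) t - w x t) =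
      cmod (sym_diff w k (x + (h / 2) *: e_ k) t (`|h| / 2)).
    rewrite /sym_diff -!addrA -scalerDl -scalerBl.
    have [h0|h0] := ger0P h.
      by rewrite subrr scale0r addr0 (_ : h / 2 + h / 2 = h)//; lra.
    rewrite (_ : h / 2 + - h / 2 = 0); last lra.
    rewrite (_ : h / 2 - - h / 2 = h); last lra.
    by rewrite scale0r addr0 -cmodN opprB.
  apply: (le_trans (W _)).
  have Eh : weight l (x + (h / 2) *: e_ k) t <= expR (l * (`|h| / 2)) * weight l x t.
    apply: weight_shift => // j; rewrite (le_trans (coordE _ _))// normrM.
    by rewrite (ger0_norm (_ : 0 <= 2^-1)) ?invr_ge0.
  apply: (@le_trans _ _ (4 * M * expR (l * s0) / s0 * (`|h| / 2) *
      (expR (l * (`|h| / 2)) * weight l x t))).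
    rewrite ler_wpM2l// mulr_ge0 ?divr_ge0//.
    by rewrite mulr_ge0 ?expR_ge0// mulr_ge0.
  have -> : 4 * M * expR (l * s0) / s0 * (`|h| / 2) * (expR (l * (`|h| / 2)) * weight l x t)
    = 2 / s0 * `|h| * M * weight l x t * (expR (l * s0) * expR (l * (`|h| / 2))).
    by field; rewrite lt0r_neq0.
  have -> : 2 * expR l / s0 * `|h| * M * weight l x t =
    2 / s0 * `|h| * M * weight l x t * expR l by field; rewrite lt0r_neq0.
  rewrite -expRD ler_wpM2l//.
    by rewrite mulr_ge0// mulr_ge0// mulr_ge0// divr_ge0.
  rewrite ler_expR -mulrDr -[X in _ <= X]mulr1 ler_wpM2l//; lra.
rewrite (le_trans (cmodB _ _))//.
have w1 := wM (x + h *: e_ k) t t0; have w2 := wM x t t0.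
have Eh : weight l (x + h *: e_ k) t <= expR l * weight l x t.
  rewrite -[X in expR X]mulr1; apply: weight_shift => // j.
  exact: le_trans (coordE _ _) h1.
have e1 : 1 <= expR l by rewrite -expR0 ler_expR.
apply: (@le_trans _ _ (2 * expR l * (M * weight l x t))).
  have : M * weight l (x + h *: e_ k) t <= M * (expR l * weight l x t) by rewrite ler_pM2l.
  have : M * weight l x t <= expR l * (M * weight l x t).
    by rewrite ler_peMl// mulr_ge0// ltW.
  lra.
have -> : 2 * expR l / s0 * `|h| * M * weight l x t =
  2 * expR l * (M * weight l x t) * (`|h| / s0) by ring.
rewrite ler_peMr//; first by rewrite mulr_ge0// mulr_ge0// expR_ge0.
rewrite ler_pdivlMr//; lra.
Qed.

(** The doubling argument works along coordinate axes only, so x is joined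
    to x + v by moving one coordinate at a time. *)
Lemma vector_lipschitz (c b l : R) : (0 < n)%N -> 0 <= c -> 0 <= b -> 0 <= l ->
  exists2 A : R, 0 < A & forall (c0 : R[i]) (b0 : 'rV[R[i]]_n) w M,
    cmod c0 <= c -> (forall j, cmod (b0 0 j) <= b) -> caloric c0 b0 w -> 0 < M ->
    weight_bound l M w ->
    forall x v t h, 0 < t -> 0 <= h <= 1 -> (forall j, `|v 0 j| <= h) ->
    cmod (w (x + v) t - w x t) <= A * h * M * weight l x t.
Proof.
move=> n0 c_ge0 b_ge0 l0; have [A A0 HA] := coord_lipschitz n0 c_ge0 b_ge0 l0.
exists (n%:R * (A * expR l)); first by rewrite !mulr_gt0 ?ltr0n ?expR_gt0.
move=> c0 b0 w M hc hb wc M0 wM x v t h t0 /andP[h0 h1] vh.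
pose part m : 'rV[R]_n := \row_j (if (j < m)%N then v 0 j else 0).
have part_le m j : `|part m 0 j| <= 1.
  by rewrite mxE; case: ifP => _; rewrite ?normr0// (le_trans (vh j)).
suff H m : (m <= n)%N ->
    cmod (w (x + part m) t - w x t) <= m%:R * (A * expR l) * h * M * weight l x t.
  have <- : part n = v by apply/rowP => j; rewrite mxE ltn_ord.
  exact: H.
elim: m => [_|m IHm mn].
  rewrite (_ : part 0%N = 0); last by apply/rowP => j; rewrite !mxE.
  by rewrite addr0 subrr cmod0 !mul0r.
pose k := Ordinal mn.
have -> : part m.+1 = part m + v 0 k *: e_ k.
  apply/rowP => j; rewrite !mxE eqxx/= ltnS.
  have [->|jk] := eqVneq j k; first by rewrite leqnn ltnn add0r mulr1.
  rewrite mulr0 addr0; congr (if _ then _ else _).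
  by rewrite ltn_neqAle -(inj_eq val_inj) in jk *; rewrite jk.
have -> : w (x + (part m + v 0 k *: e_ k)) t - w x t =
  (w (x + part m + v 0 k *: e_ k) t - w (x + part m) t) + (w (x + part m) t - w x t).
  by rewrite addrA addrA subrK.
rewrite (le_trans (cmodD _ _))//.
have H1 := HA c0 b0 w M hc hb wc M0 wM k (x + part m) t (v 0 k) t0
  (le_trans (vh k) h1).
have H2 := IHm (ltnW mn).
have : A * `|v 0 k| * M * weight l (x + part m) t <=
    A * expR l * h * M * weight l x t.
  have := @weight_shift R n l 1 x (part m) t l0 (part_le m); rewrite mulr1 => hE.
  have -> : A * expR l * h * M * weight l x t = A * h * M * (expR l * weight l x t) by ring.
  apply: ler_pM => //; rewrite ?weight_ge0// ?mulr_ge0 ?(ltW A0) ?(ltW M0)//.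
  by rewrite ler_pM2r// ler_pM2l.
rewrite -[m.+1]addn1 natrD; lra.
Qed.

Definition increment v w : 'rV[R]_n -> R -> R[i] := fun x t => w (x + v) t - w x t.

(** The coefficients of the equation are constant. *)
Lemma caloric_increment c0 b0 v w : caloric c0 b0 w -> caloric c0 b0 (increment v w).
Proof.
move=> [wt [w1 [w2 [cw hwt hw hpde]]]].
exists (increment v wt), (fun j => increment v (w1 j)), (fun j => increment v (w2 j)); split.
- move=> p p0; have [R1 I1] := cw p p0; have [R2 I2] := cw (p.1 + v, p.2) p0.
  have sh (f : 'rV[R]_n * R -> R) : {for (p.1 + v, p.2), continuous f} ->
      (fun q : 'rV[R]_n * R => f (q.1 + v, q.2)) @ p --> f (p.1 + v, p.2).
    move=> cf; apply: (cvg_comp _ f _ cf).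
    have h1 : (fun q : 'rV[R]_n * R => q.1 + v) @ p --> p.1 + v.
      by apply: cvgD; [exact: cvg_fst|exact: cvg_cst].
    have h2 : (fun q : 'rV[R]_n * R => q.2) @ p --> p.2 by exact: cvg_snd.
    exact: (cvg_pair h1 h2).
  split.
    rewrite (_ : (fun q => _) = fun q : 'rV[R]_n * R =>
      complex.Re (w (q.1 + v) q.2) - complex.Re (w q.1 q.2)).
      exact: (cvgB (sh _ R2) R1).
    by apply/funext => q; rewrite /increment raddfB.
  rewrite (_ : (fun q => _) = fun q : 'rV[R]_n * R =>
      complex.Im (w (q.1 + v) q.2) - complex.Im (w q.1 q.2)).
    exact: (cvgB (sh _ I2) I1).
  by apply/funext => q; rewrite /increment raddfB.
- by move=> x t t0; apply: cis_deriveB; exact: hwt.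
- move=> j x s t t0; have [h1 h2] := hw j x s t t0.
  have [h3 h4] := hw j (x + v) s t t0.
  split; rewrite /increment; under [X in cis_derive X]eq_fun do rewrite addrAC;
    rewrite [_ + _ + v]addrAC; exact: cis_deriveB.
- move=> x t t0; rewrite /increment.
  have sE (f g : 'I_n -> R[i]) : \sum_j (f j - g j) = \sum_j f j - \sum_j g j.
    by rewrite -sumrN -big_split.
  under [X in _ = _ + X]eq_bigr do rewrite mulrBr.
  by rewrite !sE mulrBr addrACA -opprD hpde// hpde// opprD addrACA.
Qed.

(** Each increment gains a factor A h and leaves the weight as it is; no part
    of the domain is lost, so that the constants do not depend on N. *)
Lemma iter_increment_bound (c b l : R) : (0 < n)%N -> 0 <= c -> 0 <= b -> 0 <= l ->
  exists2 A : R, 0 < A & forall (c0 : R[i]) (b0 : 'rV[R[i]]_n) w M,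
    cmod c0 <= c -> (forall j, cmod (b0 0 j) <= b) -> caloric c0 b0 w -> 0 < M ->
    weight_bound l M w ->
    forall N v h, 0 < h <= 1 -> (forall j, `|v 0 j| <= h) ->
    weight_bound l ((A * h) ^+ N * M) (iter N (increment v) w).
Proof.
move=> n0 c_ge0 b_ge0 l0; have [A A0 HA] := vector_lipschitz n0 c_ge0 b_ge0 l0.
exists A => // c0 b0 w M hc hb wc M0 wM N v h /andP[h0 h1] vh.
suff [] : caloric c0 b0 (iter N (increment v) w) /\
    weight_bound l ((A * h) ^+ N * M) (iter N (increment v) w) by [].
elim: N => [|N [IH1 IH2]]; first by rewrite expr0 mul1r.
split; first exact: caloric_increment.
move=> x t t0; rewrite iterS /increment.
have MN : 0 < (A * h) ^+ N * M by rewrite mulr_gt0// exprn_gt0// mulr_gt0.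
have h01 : 0 <= h <= 1 by rewrite (ltW h0).
have := HA c0 b0 _ _ hc hb IH1 MN IH2 x v t h t0 h01 vh.
by rewrite exprS -!mulrA.
Qed.

Definition cont_at0 w := forall x e, 0 < e ->
  exists2 d : R, 0 < d & forall t, 0 < t < d -> cmod (w x t - w x 0) <= e.

Lemma cont_at0_increment v w : cont_at0 w -> cont_at0 (increment v w).
Proof.
move=> wc x e e0; have e20 : 0 < e / 2 by rewrite divr_gt0.
have [d1 d10 h1] := wc x _ e20; have [d2 d20 h2] := wc (x + v) _ e20.
exists (Num.min d1 d2); first by rewrite lt_min d10.
move=> t /andP[t0]; rewrite lt_min => /andP[td1 td2].
have := h1 t; rewrite t0 td1 => /(_ isT) g1.
have := h2 t; rewrite t0 td2 => /(_ isT) g2.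
have -> : increment v w x t - increment v w x 0 =
  (w (x + v) t - w (x + v) 0) - (w x t - w x 0) by rewrite /increment; ring.
rewrite (le_trans (cmodB _ _))//; lra.
Qed.

Lemma cont_at0_bound l M w x : 0 <= l -> 0 <= M -> cont_at0 w ->
  weight_bound l M w -> cmod (w x 0) <= M * (expR l * coshsum l x).
Proof.
move=> l0 M0 wc wM; apply/ler_addgt0Pr => e e0.
have [d d0 hd] := wc x e e0.
pose t := Num.min d 1 / 2.
have m0 : 0 < Num.min d 1 by rewrite lt_min d0 ltr01.
have t0 : 0 < t by rewrite divr_gt0.
have : t < Num.min d 1 by rewrite /t; lra.
rewrite lt_min => /andP[td t1].
have -> : w x 0 = w x t - (w x t - w x 0) by rewrite opprB addrC subrK.
rewrite (le_trans (cmodB _ _))// lerD ?hd ?t0//.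
rewrite (le_trans (wM x t t0))// ler_wpM2l// ler_wpM2r ?coshsum_ge0// ler_expR.
by rewrite -[X in _ <= X]mulr1 ler_wpM2l// ltW.
Qed.

(** The bound passes to the limit t = 0 by continuity; the factor e^l comes from
    the times t <= 1. *)
Lemma iter_increment_at0 (c b l : R) : (0 < n)%N -> 0 <= c -> 0 <= b -> 0 <= l ->
  exists2 A : R, 0 < A & forall (c0 : R[i]) (b0 : 'rV[R[i]]_n) w M,
    cmod c0 <= c -> (forall j, cmod (b0 0 j) <= b) -> caloric c0 b0 w -> 0 < M ->
    weight_bound l M w -> cont_at0 w ->
    forall N v h x, 0 < h <= 1 -> (forall j, `|v 0 j| <= h) ->
    cmod (iter N (increment v) w x 0) <= (A * h) ^+ N * M * (expR l * coshsum l x).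
Proof.
move=> n0 c_ge0 b_ge0 l0; have [A A0 HA] := iter_increment_bound n0 c_ge0 b_ge0 l0.
exists A => // c0 b0 w M hc hb wc M0 wM w0 N v h x hh vh.
apply: cont_at0_bound => //.
- case/andP: hh => h0 _.
  by rewrite mulr_ge0 ?(ltW M0)// exprn_ge0// mulr_ge0 ?(ltW A0) ?(ltW h0).
- by elim: N => // N IH; exact: cont_at0_increment.
- exact: (HA c0 b0).
Qed.

End iterate.

(** * Extrapolation of a function with small differences *)

Section extrapolation.
Variable R : realType.

Definition fdiff (a : nat -> R[i]) : nat -> R[i] := fun i => a i.+1 - a i.

Lemma iter_fdiff_bound (a : nat -> R[i]) (N p : nat) (eps : R) :
  (forall i, (i < N)%N -> cmod (a (p + i)%N) <= eps) ->
  forall k i, (k + i < N)%N -> cmod (iter k fdiff a (p + i)%N) <= 2 ^+ k * eps.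
Proof.
move=> ha; elim=> [i|k IH i kiN]; first by rewrite expr0 mul1r; exact: ha.
rewrite iterS /fdiff (le_trans (cmodB _ _))// -addnS.
have h1 := IH i.+1; rewrite addnS in h1; have h2 := IH i (ltnW kiN).
have := h1 kiN; rewrite exprS; lra.
Qed.

(** Backward recursion D^k a (i) = D^k a (i+1) - D^(k+1) a (i) in the table of
    differences.  At j steps before the known values, the bound X q^j r^k on
    the k-th difference, where q = 1 / (1 - r), reproduces itself exactly, as
      q^j r^k + q^(j+1) r^(k+1) = q^(j+1) r^k.
    The lower bounds on X start the recursion, at j = 0 and at k = N. *)
Lemma extrapolate_seq (a : nat -> R[i]) (N p : nat) (eps eta r X : R) :
  (0 < N)%N -> 0 <= eps -> 0 < r < 1 ->
  eps * (2 / r) ^+ N <= X -> eta <= X * r ^+ N ->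
  (forall i, (i < p)%N -> cmod (iter N fdiff a i) <= eta) ->
  (forall i, (i < N)%N -> cmod (a (p + i)%N) <= eps) ->
  cmod (a 0%N) <= X * (1 - r)^-1 ^+ p.
Proof.
move=> N0 eps0 /andP[r0 r1] hX heta hdiff ha.
have X0 : 0 <= X.
  by rewrite (le_trans _ hX)// mulr_ge0// exprn_ge0// divr_ge0// ltW.
have q0 : 0 < 1 - r by lra.
have q1 : 1 <= (1 - r)^-1 by rewrite invf_ge1//; lra.
suff H j : forall i, (j + i = p)%N -> forall k, (k < N)%N ->
    cmod (iter k fdiff a i) <= X * (1 - r)^-1 ^+ j * r ^+ k.
  by have := H p 0%N (addn0 p) 0%N N0; rewrite expr0 mulr1.
elim: j => [i|j IH i jip k kN].
  rewrite add0n => -> k kN; rewrite expr0 mulr1.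
  have := iter_fdiff_bound ha (k := k) (i := 0); rewrite !addn0 => /(_ kN) h.
  rewrite (le_trans h)//.
  apply: (@le_trans _ _ (eps * (2 / r) ^+ N * r ^+ k)); last first.
    by rewrite ler_wpM2r// exprn_ge0// ltW.
  have -> : N = (k + (N - k))%N by rewrite subnKC// ltnW.
  rewrite exprD !exprMn.
  have -> : eps * (2 ^+ k * r^-1 ^+ k * (2 ^+ (N - k) * r^-1 ^+ (N - k))) * r ^+ k =
      2 ^+ k * eps * (2 / r) ^+ (N - k) * (r^-1 * r) ^+ k by rewrite !exprMn; ring.
  rewrite mulVf ?lt0r_neq0// expr1n mulr1 ler_peMr ?mulr_ge0 ?exprn_ge0//.
  by rewrite exprn_ege1// ler_pdivlMr//; lra.
have ip : (i < p)%N by rewrite -jip addSn ltnS leq_addl.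
have jp : (j + i.+1 = p)%N by rewrite addnS -addSn.
suff G m : forall k, (k + m = N)%N ->
    cmod (iter k fdiff a i) <= X * (1 - r)^-1 ^+ j.+1 * r ^+ k.
  by apply: (G (N - k)%N); rewrite subnKC// ltnW.
elim: m => {k kN} [k|m IHm k kmN].
  rewrite addn0 => ->; rewrite (le_trans (hdiff i ip))// (le_trans heta)//.
  rewrite ler_wpM2r ?exprn_ge0 ?(ltW r0)// ler_peMr// exprn_ege1//.
have kN : (k < N)%N by rewrite -kmN addnS ltnS leq_addr.
have -> : iter k fdiff a i = iter k fdiff a i.+1 - iter k.+1 fdiff a i.
  by rewrite iterS /fdiff opprB addrC subrK.
rewrite (le_trans (cmodB _ _))//.
have h1 := IH _ jp k kN; have h2 := IHm k.+1; rewrite addSnnS in h2.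
have {}h2 := h2 kmN.
suff -> : X * (1 - r)^-1 ^+ j.+1 * r ^+ k =
  X * (1 - r)^-1 ^+ j * r ^+ k + X * (1 - r)^-1 ^+ j.+1 * r ^+ k.+1 by exact: lerD.
by rewrite !exprS; field; rewrite lt0r_neq0.
Qed.

Variable n : nat.
Implicit Types (w : 'rV[R]_n -> R -> R[i]) (x y v : 'rV[R]_n).

Lemma iter_fdiff_increment w y v t k i :
  iter k fdiff (fun i => w (y + i%:R *: v) t) i = iter k (increment v) w (y + i%:R *: v) t.
Proof.
elim: k i => // k IH i; rewrite !iterS /fdiff !IH /increment.
by rewrite -[i.+1]addn1 natrD scalerDl scale1r addrA.
Qed.

(** What is kept of the equation from here on: N-th differences at time 0 as
    small as those of an entire function of exponential type. *)
Definition diff_bound (A K l : R) w := forall N v h x,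
  0 < h <= 1 -> (forall j, `|v 0 j| <= h) ->
  cmod (iter N (increment v) w x 0) <= (A * h) ^+ N * K * coshsum l x.

(** The segment from y to x is cut into N J steps; the N nodes from x onwards
    exceed x by at most one J-th of the segment.  With r = 1 / (J + 1) the
    factor (1 - r)^-(N J) = (1 + 1 / J)^(N J) is at most e^N. *)
Lemma extrapolate_at0 (A K l : R) w : 0 < A -> 0 < K -> 0 <= l ->
  diff_bound A K l w ->
  forall (N J : nat) (rho eps : R) x y, (0 < N)%N -> (0 < J)%N -> 0 < rho ->
  2 * rho <= J%:R -> 0 <= eps ->
  (forall j, `|x 0 j| <= rho) -> (forall j, `|y 0 j| <= rho) ->
  (forall z : 'rV[R]_n, (forall j, `|z 0 j - x 0 j| <= 2 * rho / J%:R) -> cmod (w z 0) <= eps) ->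
  cmod (w y 0) <= expR N%:R * (eps * (2 * J.+1%:R) ^+ N
     + (4 * A * rho / N%:R) ^+ N * K * (2 * n%:R * expR (l * rho))).
Proof.
move=> A0 K0 l0 wD N J rho eps x y N0 J0 rho0 rJ eps0 xr yr hz.
have NR : 0 < N%:R :> R by rewrite ltr0n.
have JR : 0 < J%:R :> R by rewrite ltr0n.
have NJ : 0 < (N * J)%:R :> R by rewrite ltr0n muln_gt0 N0.
pose v := (N * J)%:R^-1 *: (x - y).
pose h := 2 * rho / (N * J)%:R.
have h0 : 0 < h by rewrite divr_gt0// mulr_gt0.
have h1 : h <= 1.
  rewrite ler_pdivrMr// mul1r (le_trans rJ)// ler_nat leq_pmull//.
have vh j : `|v 0 j| <= h.
  rewrite !mxE normrM ger0_norm ?invr_ge0 ?(ltW NJ)// mulrC ler_pM2r ?invr_gt0//.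
  by rewrite (le_trans (ler_normB _ _))// mulr2n mulrDl mul1r lerD.
pose S := 2 * n%:R * expR (l * rho).
have S0 : 0 <= S by rewrite mulr_ge0 ?expR_ge0// mulr_ge0.
pose r : R := J.+1%:R^-1.
have J1 : 0 < J.+1%:R :> R by rewrite ltr0n.
have r0 : 0 < r by rewrite invr_gt0.
have r1 : r < 1 by rewrite invf_lt1// ltr1n.
pose X := eps * (2 * J.+1%:R) ^+ N + (4 * A * rho / N%:R) ^+ N * K * S.
have B0 : 0 <= (4 * A * rho / N%:R) ^+ N * K * S.
  by rewrite mulr_ge0// mulr_ge0 ?(ltW K0)// exprn_ge0// divr_ge0// !mulr_ge0// ltW.
have Y0 : y = y + 0%:R *: v by rewrite scale0r addr0.
rewrite [in X in X <= _]Y0.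
have r01 : 0 < r < 1 by rewrite r0.
apply: (@le_trans _ _ (X * (1 - r)^-1 ^+ (N * J)%N)).
  apply: (@extrapolate_seq (fun i => w (y + i%:R *: v) 0) N (N * J)%N eps
    ((A * h) ^+ N * K * S) r X N0 eps0 r01).
  - by rewrite /r invrK lerDl.
  - rewrite mulrDl; apply: ler_wpDl.
      by rewrite mulr_ge0 ?exprn_ge0 ?(ltW r0)// mulr_ge0// exprn_ge0// mulr_ge0.
    have -> : (4 * A * rho / N%:R) ^+ N * K * S * r ^+ N =
      (4 * A * rho / N%:R * r) ^+ N * K * S by rewrite [in RHS]exprMn; ring.
    rewrite ler_wpM2r// ler_wpM2r ?(ltW K0)// lerXn2r ?nnegrE//.
    + by rewrite mulr_ge0// ltW.
    + by rewrite mulr_ge0 ?(ltW r0)// divr_ge0// !mulr_ge0// ltW.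
    rewrite /h /r natrM.
    have -> : A * (2 * rho / (N%:R * J%:R)) = 2 * A * rho / N%:R * J%:R^-1.
      by field; rewrite !lt0r_neq0.
    have -> : 4 * A * rho / N%:R * J.+1%:R^-1 = 2 * A * rho / N%:R * (2 * J.+1%:R^-1).
      by field; rewrite !lt0r_neq0.
    rewrite ler_pM2l ?divr_gt0 ?mulr_gt0// ler_pdivlMr// mulrC ler_pdivrMr//.
    by have : 1 <= J%:R :> R; [rewrite ler1n|rewrite -natr1; lra].
  - move=> i iNJ; rewrite iter_fdiff_increment.
    have h01 : 0 < h <= 1 by rewrite h0.
    rewrite (le_trans (wD N v h _ h01 vh))// ler_wpM2l//.
      by rewrite mulr_ge0 ?(ltW K0)// exprn_ge0// mulr_ge0// ltW.
    apply: coshsum_le => // j.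
    pose th : R := i%:R / (N * J)%:R.
    have th0 : 0 <= th by rewrite divr_ge0// ltW.
    have th1 : th <= 1 by rewrite ler_pdivrMr// mul1r ler_nat ltnW.
    have -> : (y + i%:R *: v) 0 j = (1 - th) * y 0 j + th * x 0 j.
      by rewrite !mxE /th; field; rewrite !lt0r_neq0.
    clearbody th.
    rewrite (le_trans (ler_normD _ _))// !normrM (ger0_norm th0) ger0_norm ?subr_ge0//.
    have := ler_wpM2l th0 (xr j).
    have : (1 - th) * `|y 0 j| <= (1 - th) * rho by rewrite ler_wpM2l ?subr_ge0.
    lra.
  - move=> i iN; apply: hz => j.
    have -> : (y + (N * J + i)%:R *: v) 0 j - x 0 j = i%:R * v 0 j.
      by rewrite !mxE natrD; field; rewrite !lt0r_neq0.
    rewrite normrM ger0_norm//.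
    apply: (@le_trans _ _ (N%:R * h)).
      by apply: ler_pM => //; rewrite ler_nat ltnW.
    rewrite /h natrM; have -> // : N%:R * (2 * rho / (N%:R * J%:R)) = 2 * rho / J%:R.
    by field; rewrite !lt0r_neq0.
have X0 : 0 <= X by rewrite addr_ge0// mulr_ge0// exprn_ge0// mulr_ge0.
rewrite mulrC -/S -/X ler_wpM2r//.
have -> : (1 - r)^-1 = 1 + J%:R^-1.
  by rewrite /r -natr1; field; rewrite natr1 !lt0r_neq0.
apply: (@le_trans _ _ (expR J%:R^-1 ^+ (N * J)%N)).
  by apply: lerXn2r; rewrite ?nnegrE ?expR_ge0 ?expR_ge1Dx//.
by rewrite -expRM_natr natrM mulrCA mulVf ?lt0r_neq0// mulr1.
Qed.

End extrapolation.

(** * Integrals over cubes *)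

(** The integral of a nonnegative function is the supremum of the integrals of
    the simple functions below it, and as such monotone, be the functions
    measurable or not. *)
Lemma le_integral_patch d (T : measurableType d) (R : realType)
    (mu : {measure set T -> \bar R}) (D E : set T) (f g : T -> \bar R) :
  (forall x, D x -> 0 <= f x)%E -> (forall x, E x -> 0 <= g x)%E ->
  (forall x, (f \_ D) x <= (g \_ E) x)%E ->
  (\int[mu]_(x in D) f x <= \int[mu]_(x in E) g x)%E.
Proof.
move=> f0 g0 fg; rewrite !ge0_integralE//; apply: ereal_sup_le => _ [h hf <-].
by exists h => // x; exact: le_trans (hf x) (fg x).
Qed.

Section box.
Variable R : realType.

Definition box n (z : 'I_n -> R) (rho : R) : set (n.-tuple (measurableTypeR R)) :=
  [set t | forall j, `|tnth t j - z j| <= rho].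

Lemma inord_lift0 n (j : 'I_n) : inord j.+1 = lift ord0 j :> 'I_n.+1.
Proof. by apply: ord_inj; rewrite lift0 inordK ?ltnS. Qed.

Lemma boxS n (z : 'I_n.+1 -> R) rho : @box n.+1 z rho =
  [set t | `[z ord0 - rho, z ord0 + rho]%classic (thead t) /\
    @box n (fun j => z (lift ord0 j)) rho [tuple of behead t]].
Proof.
apply/seteqP; split => t /=.
  move=> h; split => [|j]; first by rewrite in_itv/= -ler_distl; exact: h.
  by rewrite tnth_behead inord_lift0; exact: h.
move=> [h1 h2] j; case: (unliftP ord0 j) => [i ->|->].
  by have := h2 i; rewrite tnth_behead inord_lift0.
by move: h1; rewrite in_itv/= -ler_distl.
Qed.

Lemma measurable_box n (z : 'I_n -> R) rho : measurable (box z rho).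
Proof.
elim: n z => [z|n IH z].
  by rewrite (_ : box z rho = setT)//; apply/seteqP; split => // t _ [].
rewrite boxS; apply: measurableI.
  by rewrite -[X in measurable X]setTI; exact: measurable_tnth.
rewrite -[X in measurable X]setTI; exact: measurable_behead.
Qed.

Lemma lebesgue_box n (z : 'I_n -> R) rho : 0 <= rho ->
  @lebesgue_tuple R n (box z rho) = ((2 * rho) ^+ n)%:E.
Proof.
move=> rho0; elim: n z => [z|n IH z].
  rewrite (_ : box z rho = setT); last by apply/seteqP; split => // t _ [].
  by rewrite /= diracT expr0.
rewrite /= /pushforward boxS tuple_conspE.
have [mu E] := lebesgue_tuple_sigma_finite R n.
rewrite E product_measure1E//; last exact: measurable_box.
rewrite -E IH exprS EFinM; congr (_ * _)%E.
have -> : (2 * rho)%:E = @lebesgue_measure R `[z ord0 - rho, z ord0 + rho]%classic.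
  rewrite lebesgue_measure_itv/= lte_fin; case: ltP => [h|h].
    by rewrite -EFinD; congr (_)%:E; ring.
  by congr (_)%:E; lra.
by [].
Qed.

Variable n : nat.
Implicit Types (A : set 'rV[R]_n) (f : 'rV[R]_n -> R).

Lemma integral_rV_ge A f (z : 'rV[R]_n) (rho a : R) : 0 <= rho -> 0 <= a ->
  (forall x, 0 <= f x) ->
  (forall x : 'rV[R]_n, (forall j, `|x 0 j - z 0 j| <= rho) -> A x /\ a <= f x) ->
  ((a * (2 * rho) ^+ n)%:E <= integral_rV A f)%E.
Proof.
move=> rho0 a0 f0 h.
rewrite EFinM -(lebesgue_box (fun j => z 0 j) rho0).
rewrite -[X in (X <= _)%E](integral_cst _ (measurable_box _ _)).
apply: le_integral_patch => [x _|x _|t] /=; rewrite ?lee_fin//.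
rewrite /patch; case: ifPn => [|_]; last first.
  by case: ifPn => // _; rewrite lee_fin.
rewrite inE => tb.
have [Av fv] : A (\row_j tnth t j) /\ a <= f (\row_j tnth t j).
  by apply: h => j; rewrite mxE; exact: tb.
by rewrite ifT ?inE// lee_fin.
Qed.

Lemma integral_rV_le A f (z : 'rV[R]_n) (rho a : R) : 0 <= rho -> 0 <= a ->
  (forall x, 0 <= f x) ->
  (forall x : 'rV[R]_n, A x -> (forall j, `|x 0 j - z 0 j| <= rho) /\ f x <= a) ->
  (integral_rV A f <= (a * (2 * rho) ^+ n)%:E)%E.
Proof.
move=> rho0 a0 f0 h.
rewrite EFinM -(lebesgue_box (fun j => z 0 j) rho0).
rewrite -[X in (_ <= X)%E](integral_cst _ (measurable_box _ _)).
apply: le_integral_patch => [x _|x _|t] /=; rewrite ?lee_fin//.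
rewrite /patch; case: ifPn => [|_]; last first.
  by case: ifPn => // _; rewrite lee_fin.
rewrite inE => tb; have [Av fv] := h _ tb.
rewrite ifT ?lee_fin// inE => j; have := Av j; by rewrite mxE.
Qed.

End box.

(** * Solutions at time 0 *)

Section solutions.
Variables (R : realType) (n : nat).
Implicit Types (u : 'rV[R]_n -> R -> R[i]) (x : 'rV[R]_n) (t : R).
Local Notation e_ := (@unit_vec R n).

Lemma is_derive_line (f : 'rV[R]_n -> R) (x v : 'rV[R]_n) (s : R) :
  derivable f (x + s *: v) v ->
  is_derive s 1 (fun r : R => f (x + r *: v)) ('D_v f (x + s *: v)).
Proof.
move=> df.
have E : (fun h : R => h^-1 *: (((fun r : R => f (x + r *: v)) \o shift s) (h *: 1)
      - f (x + s *: v))) =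
    (fun h : R => h^-1 *: ((f \o shift (x + s *: v)) (h *: v) - f (x + s *: v))).
  apply/funext => h /=; congr (_ *: (f _ - _)).
  by rewrite -[h *: 1]/(h * 1) mulr1 scalerDl addrCA.
by split; rewrite /derivable /derive E.
Qed.

Lemma cis_derive_line (f : 'rV[R]_n -> R[i]) (x v : 'rV[R]_n) (s : R) :
  cderivable f (x + s *: v) v ->
  cis_derive (fun r => f (x + r *: v)) s (cderive f (x + s *: v) v).
Proof.
by move=> [d1 d2]; split;
  [exact: (is_derive_line (f := fun y => complex.Re (f y)))
  |exact: (is_derive_line (f := fun y => complex.Im (f y)))].
Qed.

Lemma caloric_solution c0 b0 u : is_solution c0 b0 u -> caloric c0 b0 u.
Proof.
move=> [_ [hd [cR cI] _ _ _] pde].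
exists (dt u), (fun j => dx j u), (fun j => dx j (dx j u)); split.
- have oQ : open [set p : 'rV[R]_n * R | 0 < p.2].
    apply: (@open_comp _ _ (fun p : 'rV[R]_n * R => p.2) [set r | 0 < r]).
      by move=> p _; exact: cvg_snd.
    exact: open_gt.
  rewrite continuous_open_subspace// in cR; rewrite continuous_open_subspace// in cI.
  by move=> p p0; split; [apply: cR|apply: cI]; rewrite inE.
- move=> x t t0; have [[d1 d2] _ _] := hd x t t0.
  by split; exact: derivableP.
- move=> j x s t t0; have [_ d1 d2] := hd (x + s *: e_ j) t t0; split.
    exact: (cis_derive_line (d1 j)).
  exact: (cis_derive_line (d2 j j)).
- exact: pde.
Qed.

Lemma cont_at0_solution c0 b0 u : is_solution c0 b0 u -> cont_at0 u.
Proof.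
move=> [[cR cI] _ _] x e e0.
have aux (f : 'rV[R]_n * R -> R) : {within [set p | 0 <= p.2], continuous f} ->
    exists2 d : R, 0 < d & forall t, 0 < t < d -> `|f (x, t) - f (x, 0)| <= e / 2.
  move=> /subspace_continuousP/(_ (x, 0) (lexx _))/cvgrPdist_le/(_ (e / 2)); rewrite divr_gt0// => /(_ isT).
  rewrite near_withinE => /nbhs_ballP[d /= d0 hd].
  exists d => // t /andP[t0 td]; rewrite distrC; apply: hd => /=; last exact: ltW.
  split => /=; first exact: ballxx.
  by rewrite /ball/= sub0r normrN gtr0_norm.
have [d1 d10 h1] := aux _ cR; have [d2 d20 h2] := aux _ cI.
exists (Num.min d1 d2); first by rewrite lt_min d10.
move=> t /andP[t0]; rewrite lt_min => /andP[td1 td2].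
rewrite (le_trans (cmod_le _))// !raddfB/=.
have := h1 t; rewrite t0 td1 => /(_ isT); have := h2 t; rewrite t0 td2 => /(_ isT) /=.
lra.
Qed.

Lemma enorm_ge0 x : 0 <= enorm x.
Proof. by rewrite sqrtr_ge0. Qed.

Lemma coord_le_enorm x j : `|x 0 j| <= enorm x.
Proof.
rewrite -sqrtr_sqr ler_wsqrtr// (bigD1 j)//= lerDl sumr_ge0// => i _.
exact: sqr_ge0.
Qed.

Lemma enorm_le x a : (forall j, `|x 0 j| <= a) -> enorm x <= n%:R * a.
Proof.
case: (posnP n) => [n0|n0] xa.
  rewrite /enorm big1 ?sqrtr0; first by rewrite n0 mul0r.
  by move=> j _; have := ltn_ord j; rewrite {2}n0.
have a0 : 0 <= a by rewrite (le_trans _ (xa (Ordinal n0))).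
rewrite -[_ * _]ger0_norm ?mulr_ge0// -sqrtr_sqr ler_wsqrtr//.
apply: (@le_trans _ _ (n%:R * a ^+ 2)).
  rewrite mulr_natl -[n in X in _ <= X]card_ord -sumr_const; apply: ler_sum => j _.
  by rewrite -(real_normK (num_real (x 0 j))) lerXn2r ?nnegrE.
rewrite exprMn ler_wpM2r ?sqr_ge0// expr2 ler_peMr// ler1n//.
Qed.

(** The rate C n and the factor e^C come from |x| <= n max_j |x_j| and
    sqrt t <= 1 + t. *)
Lemma weight_bound_growth (C : R) u : (0 < n)%N -> 0 <= C ->
  (forall x t, 0 <= t -> cmod (u x t) <= C * expR (C * (enorm x + Num.sqrt `|t|))) ->
  weight_bound (C * n%:R) (C * expR C + 1) u.
Proof.
move=> n0 C0 hu x t t0; rewrite (le_trans (hu x t (ltW t0)))//.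
have [i _ imax] := @arg_maxP _ _ _ (Ordinal n0) xpredT (fun j => `|x 0 j|) isT.
have n1 : 1 <= n%:R :> R by rewrite ler1n.
have h1 : enorm x <= n%:R * `|x 0 i| by apply: enorm_le => j; exact: imax.
have h2 : Num.sqrt `|t| <= 1 + t.
  rewrite gtr0_norm// -[1 + t]ger0_norm; last by lra.
  by rewrite -sqrtr_sqr ler_wsqrtr// sqrrD; have := sqr_ge0 t; lra.
have S2 : expR (C * n%:R * `|x 0 i|) <= coshsum (C * n%:R) x.
  by apply: expR_le_coshsum; rewrite mulr_ge0.
apply: (@le_trans _ _ (C * (expR C * (expR (C * n%:R * t) * expR (C * n%:R * `|x 0 i|))))).
  rewrite ler_wpM2l// -!expRD ler_expR.
  have : C * enorm x <= C * (n%:R * `|x 0 i|) by rewrite ler_wpM2l.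
  have : C * Num.sqrt `|t| <= C * (1 + t) by rewrite ler_wpM2l.
  have : C * t <= C * n%:R * t by rewrite ler_pM2r// ler_peMr.
  lra.
rewrite mulrA; apply: ler_pM; rewrite ?mulr_ge0 ?expR_ge0 ?lerDl//.
by rewrite /weight ler_wpM2l ?expR_ge0.
Qed.

Lemma le_cenorm (b : 'rV[R[i]]_n) j : cmod (b 0 j) <= cenorm b.
Proof.
rewrite -[cmod _]ger0_norm ?cmod_ge0// -sqrtr_sqr ler_wsqrtr// (bigD1 j)//= lerDl.
by apply: sumr_ge0 => i _; exact: sqr_ge0.
Qed.

Lemma solution_diff_bound (C b c : R) : (0 < n)%N -> 0 <= C ->
  exists2 A : R, 0 < A & forall c0 (b0 : 'rV[R[i]]_n) u,
    cmod c0 = c -> cenorm b0 = b -> is_solution c0 b0 u ->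
    (forall x t, 0 <= t -> cmod (u x t) <= C * expR (C * (enorm x + Num.sqrt `|t|))) ->
    diff_bound A ((C * expR C + 1) * expR (C * n%:R)) (C * n%:R) u.
Proof.
move=> n0 C0.
have [A A0 HA] := @iter_increment_at0 R n `|c| `|b| (C * n%:R) n0 (normr_ge0 _) (normr_ge0 _)
  (mulr_ge0 C0 (ler0n _ _)).
exists A => // c0 b0 u hc hb us hu N v h x hh vh.
rewrite mulrA -mulrA; apply: (HA c0 b0) => //.
- by rewrite hc ler_norm.
- by move=> j; rewrite (le_trans (le_cenorm _ _))// hb ler_norm.
- exact: caloric_solution us.
- by rewrite ltr_wpDl// mulr_ge0// expR_ge0.
- exact: weight_bound_growth.
- exact: cont_at0_solution us.
Qed.

(** On the cube of half side h about z the values of w differ from w z 0 by at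
    most e / 2, by the difference bound with N = 1. *)
Lemma integral_ge_point (A K l h e : R) w (D : set 'rV[R]_n) (z : 'rV[R]_n) :
  diff_bound A K l w -> 0 < h <= 1 -> 0 <= e ->
  A * h * K * coshsum l z <= e / 2 -> e <= cmod (w z 0) ->
  (forall x, (forall j, `|x 0 j - z 0 j| <= h) -> D x) ->
  (((e / 2) ^+ 2 * (2 * h) ^+ n)%:E <= integral_rV D (fun x => cmod (w x 0) ^+ 2)%R)%E.
Proof.
move=> wD hh e0 hA ez hD; have /andP[h0 h1] := hh.
apply: (integral_rV_ge (z := z)); rewrite ?(ltW h0) ?sqr_ge0//.
  by move=> x; exact: sqr_ge0.
move=> x hx; split; first exact: hD.
have vh j : `|(x - z) 0 j| <= h by rewrite !mxE.
have := wD 1%N (x - z) h z hh vh; rewrite /= /increment expr1 [z + _]addrC subrK => h2.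
rewrite lerXn2r ?nnegrE ?cmod_ge0 ?divr_ge0//.
have : cmod (w z 0) <= cmod (w x 0) + cmod (w x 0 - w z 0).
  by rewrite -{1}[w z 0](subKr (w x 0)) cmodB.
lra.
Qed.

End solutions.

(** * Propagation of a lower bound *)

Section propagation.
Variables (R : realType) (n : nat).
Implicit Types (w : 'rV[R]_n -> R -> R[i]) (x y z : 'rV[R]_n).

Lemma expR_power_decay (B q : R) (N : nat) : (0 < N)%N -> 0 <= B ->
  B * expR q <= N%:R -> expR N%:R * (B / N%:R) ^+ N <= expR (- ((q - 1) * N%:R)).
Proof.
move=> N0 B0 hB; have NR : 0 < N%:R :> R by rewrite ltr0n.
have h : B / N%:R <= expR (- q).
  by rewrite ler_pdivrMr// expRN mulrC ler_pdivlMr ?expR_gt0.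
have : (B / N%:R) ^+ N <= expR (- q) ^+ N.
  by apply: lerXn2r; rewrite ?nnegrE ?expR_ge0// divr_ge0// ltW.
rewrite -expRM_natr => h2.
apply: (@le_trans _ _ (expR N%:R * expR (- q * N%:R))); first by rewrite ler_pM2l ?expR_gt0.
by rewrite -expRD ler_expR; lra.
Qed.

(** Extrapolation with eps = 0 and J fixed: the remainder
    e^N (4 A rho / N)^N tends to 0 as N grows. *)
Lemma zero_of_zero_on_cube (A K l a : R) w : 0 < A -> 0 < K -> 0 <= l ->
  diff_bound A K l w -> 0 < a ->
  (forall z, (forall j, `|z 0 j| <= a) -> w z 0 = 0) -> forall y, w y 0 = 0.
Proof.
move=> A0 K0 l0 wD a0 w0 y.
suff cy : cmod (w y 0) <= 0.
  by apply: Normc.eq0_normc; apply/eqP; rewrite eq_le cy cmod_ge0.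
rewrite leNgt; apply/negP => cy.
pose rho := enorm y + 1.
have rho0 : 0 < rho by rewrite ltr_wpDl ?enorm_ge0.
pose S : R := K * (2 * n%:R * expR (l * rho)).
have S0 : 0 <= S by rewrite mulr_ge0 ?(ltW K0)// mulr_ge0 ?expR_ge0// mulr_ge0.
pose J := (Num.trunc (2 * rho / a + 2 * rho)).+1.
have a1 : 0 <= 2 * rho / a by rewrite divr_ge0 ?(ltW a0)// mulr_ge0// ltW.
have J2 : 2 * rho / a + 2 * rho < J%:R by exact: truncnS_gt.
(* the first term gives the remainder the decay e^-N, the second one then makes
   it smaller than |w y 0| *)
pose N := (Num.trunc (4 * A * rho * expR 2 + S / cmod (w y 0))).+1.
have N2 : 4 * A * rho * expR 2 + S / cmod (w y 0) < N%:R by exact: truncnS_gt.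
have J0 : (0 < J)%N by [].
have N0 : (0 < N)%N by [].
clearbody J N.
have Ar : 0 <= 4 * A * rho by rewrite mulr_ge0 ?(ltW rho0)// mulr_ge0// ltW.
have b1 : 0 <= 4 * A * rho * expR 2 by rewrite mulr_ge0// expR_ge0.
have b2 : 0 <= S / cmod (w y 0) by rewrite divr_ge0// ltW.
have rJ : 2 * rho <= J%:R by lra.
have JR : 0 < J%:R :> R by rewrite ltr0n.
have := @extrapolate_at0 R n A K l w A0 K0 l0 wD N J rho 0 0 y N0 J0 rho0 rJ (lexx _).
have x0 j : `|(0 : 'rV[R]_n) 0 j| <= rho by rewrite mxE normr0 ltW.
have yr j : `|y 0 j| <= rho by rewrite (le_trans (coord_le_enorm y j))// lerDl.
move=> /(_ x0 yr _)/wrap[z hz|].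
  rewrite w0 ?cmod0// => j; have := hz j; rewrite mxE subr0 => /le_trans; apply.
  by rewrite ler_pdivrMr// [a * _]mulrC -ler_pdivrMr//; lra.
rewrite mul0r add0r -mulrA -/S mulrA => h.
have N4 : 4 * A * rho * expR 2 <= N%:R by lra.
have := expR_power_decay N0 Ar N4.
rewrite (_ : 2 - 1 = 1) ?mul1r; last by lra.
move=> h2; have := le_trans h (ler_wpM2r S0 h2).
rewrite expRN mulrC ler_pdivlMr ?expR_gt0// => h3.
have : S < cmod (w y 0) * N%:R by rewrite mulrC -ltr_pdivrMr//; lra.
have : cmod (w y 0) * N%:R <= cmod (w y 0) * expR N%:R.
  by rewrite ler_pM2l//; have := expR_ge1Dx (N%:R : R); lra.
lra.
Qed.

(** The threshold for w z 0 is the eps for which the first term in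
    extrapolate_at0 equals mu / 2; the remainder fills at most the other half
    of mu. *)
Lemma exists_large_point (A K l : R) w : 0 < A -> 0 < K -> 0 <= l ->
  diff_bound A K l w ->
  forall (N J : nat) (rho mu : R) x y, (0 < N)%N -> (0 < J)%N -> 0 < rho ->
  2 * rho <= J%:R -> 0 < mu ->
  (forall j, `|x 0 j| <= rho) -> (forall j, `|y 0 j| <= rho) ->
  mu < cmod (w y 0) ->
  expR N%:R * (4 * A * rho / N%:R) ^+ N * (K * (2 * n%:R * expR (l * rho))) <= mu / 2 ->
  exists2 z : 'rV[R]_n, (forall j, `|z 0 j - x 0 j| <= 2 * rho / J%:R) &
    mu / 2 / (2 * expR 1 * J.+1%:R) ^+ N <= cmod (w z 0).
Proof.
move=> A0 K0 l0 wD N J rho mu x y N0 J0 rho0 rJ mu0 xr yr wy hN.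
apply: contrapT => nz.
set e := mu / 2 / _ in nz.
have e0 : 0 <= e.
  by rewrite divr_ge0 ?exprn_ge0 ?mulr_ge0 ?expR_ge0 ?divr_ge0// ltW.
have hz (z : 'rV[R]_n) : (forall j, `|z 0 j - x 0 j| <= 2 * rho / J%:R) ->
    cmod (w z 0) <= e.
  by move=> hz; rewrite leNgt; apply/negP => h; apply: nz; exists z => //; exact: ltW.
have := extrapolate_at0 A0 K0 l0 wD N0 J0 rho0 rJ e0 xr yr hz.
rewrite mulrDr => h.
have e1 : expR N%:R * (e * (2 * J.+1%:R) ^+ N) = mu / 2.
  rewrite /e -mulrA -[X in expR X]mulr1 mulrC expRM_natl.
  have -> : (2 * expR 1 * J.+1%:R) ^+ N = expR 1 ^+ N * (2 * J.+1%:R) ^+ N :> R.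
    by rewrite -exprMn; congr (_ ^+ _); ring.
  have e1 : expR 1 ^+ N != 0 :> R by rewrite expf_neq0// lt0r_neq0// expR_gt0.
  have e2 : (2 * J.+1%:R) ^+ N != 0 :> R by rewrite expf_neq0// lt0r_neq0// mulr_gt0.
  move: e1 e2; move: (expR 1 ^+ N) ((2 * J.+1%:R) ^+ N) => a b a0 b0.
  by field; rewrite a0 b0.
rewrite e1 in h.
move: hN h wy; rewrite -!mulrA; lra.
Qed.

End propagation.

(** * Choice of the constants *)

Section numerics.
Variables (R : realType).

Lemma inv_expR_le (r : R) : 0 < r -> expR (- r) <= r^-1.
Proof.
move=> r0; rewrite expRN lef_pV2 ?posrE ?expR_gt0//.
by have := expR_ge1Dx r; lra.
Qed.

(** When N and J are of the order of r, the threshold of exists_large_point is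
    of the order of (const r)^(- const r).  The constants disappear for large
    r: 2 e (J + 1) <= r^2 and mu / 2 >= 1 / r. *)
Lemma node_value_lower (nn mu B r : R) (N J : nat) :
  1 <= nn -> 0 < mu -> 0 <= B ->
  N%:R <= B * r -> J.+1%:R <= 6 * nn * r ->
  expR 1 <= r -> 12 * nn * expR 1 <= r -> 2 / mu <= r ->
  expR (- ((2 * B + 1) * (r * ln r))) <= mu / 2 / (2 * expR 1 * J.+1%:R) ^+ N.
Proof.
move=> nn1 mu0 B0 hN hJ re rn rmu.
have r0 : 0 < r by rewrite (lt_le_trans _ re)// expR_gt0.
have r1 : 1 <= r by have := expR_ge1Dx (1 : R); lra.
have L1 : 1 <= ln r by rewrite -[X in X <= _](expRK 1) ler_ln ?posrE ?expR_gt0.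
have rE : expR (ln r) = r by rewrite lnK.
have base : 2 * expR 1 * J.+1%:R <= r ^+ 2.
  apply: (@le_trans _ _ (2 * expR 1 * (6 * nn * r))).
    by rewrite ler_pM2l// mulr_gt0// expR_gt0.
  rewrite expr2 (_ : 2 * _ * _ = (12 * nn * expR 1) * r); last by ring.
  by rewrite ler_pM2r.
have pow : (2 * expR 1 * J.+1%:R) ^+ N <= expR (2 * B * (r * ln r)).
  apply: (@le_trans _ _ ((r ^+ 2) ^+ N)).
    by apply: lerXn2r; rewrite ?nnegrE ?sqr_ge0// !mulr_ge0 ?expR_ge0.
  rewrite -exprM -{1}rE -expRM_natl ler_expR natrM.
  have : N%:R * ln r <= B * r * ln r by rewrite ler_pM2r//; lra.
  lra.
have p0 : 0 < (2 * expR 1 * J.+1%:R) ^+ N :> R.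
  by rewrite exprn_gt0// !mulr_gt0 ?expR_gt0.
rewrite ler_pdivlMr// expRN mulrC ler_pdivrMr ?expR_gt0//.
apply: (le_trans pow).
have -> : (2 * B + 1) * (r * ln r) = 2 * B * (r * ln r) + r * ln r by ring.
have hr : r <= expR (r * ln r).
  rewrite -{1}rE ler_expR ler_peMl//; lra.
have hm : 1 <= mu / 2 * expR (r * ln r).
  apply: (@le_trans _ _ (mu / 2 * r)); last by rewrite ler_pM2l// divr_gt0.
  by rewrite -ler_pdivrMl ?divr_gt0// invf_div mulr1.
have -> : mu / 2 * expR (2 * B * (r * ln r) + r * ln r) =
  mu / 2 * expR (r * ln r) * expR (2 * B * (r * ln r)) by rewrite expRD; ring.
by rewrite ler_peMl ?expR_ge0.
Qed.

End numerics.

Section lowerbound.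
Variables (R : realType) (n : nat).
Implicit Types (w : 'rV[R]_n -> R -> R[i]) (x y z : 'rV[R]_n).

(** Exponent 2 (B + 2) + 1, with B = 4 A e^(2 + l): there are N <= (B + 2) r
    steps, each costs r^2, and a last factor r absorbs mu / 2. *)
Definition value_rate (A l : R) : R := 2 * (4 * A * expR (2 + l) + 2) + 1.

(** Twice value_rate for the square of the value, (value_rate + 1 + l) n for
    the volume of the cube on which it is attained, and 2 for a factor 1 / 4. *)
Definition integral_rate (A l : R) : R :=
  2 + 2 * value_rate A l + (value_rate A l + 1 + l) * n%:R.

(** Each term is a threshold beyond which r absorbs one of the constants. *)
Definition far_radius (A K l mu : R) : R :=
  expR 1 + 12 * n%:R * expR 1 + 2 / mu + 4 * n%:R * K / mu +
  4 * n%:R * A * K * expR l.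

Lemma value_rate_ge0 A l : 0 < A -> 0 <= value_rate A l.
Proof.
move=> A0; have : 0 <= 4 * A * expR (2 + l) by rewrite mulr_ge0 ?expR_ge0// mulr_ge0// ltW.
rewrite /value_rate; lra.
Qed.

Lemma far_radius_le A K l mu r : (0 < n)%N -> 0 < A -> 0 < K -> 0 < mu ->
  far_radius A K l mu <= r ->
  [/\ expR 1 <= r, 12 * n%:R * expR 1 <= r, 2 / mu <= r, 4 * n%:R * K / mu <= r
    & 4 * n%:R * A * K * expR l <= r] /\ 4 * n%:R <= r.
Proof.
move=> n0 A0 K0 mu0; rewrite /far_radius => hr.
have nn1 : 1 <= n%:R :> R by rewrite ler1n.
have e1 : 2 <= expR 1 :> R by have := expR_ge1Dx (1 : R); lra.
have p2 : 0 <= 2 / mu by rewrite divr_ge0// ltW.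
have p3 : 0 <= 4 * n%:R * K / mu by rewrite divr_ge0 ?(ltW mu0)// mulr_ge0 ?(ltW K0)// mulr_ge0.
have p4 : 0 <= 4 * n%:R * A * K * expR l.
  by rewrite mulr_ge0 ?expR_ge0// mulr_ge0 ?(ltW K0)// mulr_ge0 ?(ltW A0)// mulr_ge0.
have p1 : 12 * n%:R * 2 <= 12 * n%:R * expR 1 :> R by rewrite ler_wpM2l// mulr_ge0.
by split; first split; lra.
Qed.

Lemma remainder_le (A K l mu r : R) (N : nat) : 0 < A -> 0 < K -> 0 <= l -> 0 < mu ->
  0 < r -> (0 < N)%N -> 4 * A * expR (2 + l) * r <= N%:R -> r <= N%:R ->
  4 * n%:R * K / mu <= r ->
  expR N%:R * (4 * A * r / N%:R) ^+ N * (K * (2 * n%:R * expR (l * r))) <= mu / 2.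
Proof.
move=> A0 K0 l0 mu0 r0 N0 NB rN rK.
have A4 : 0 <= 4 * A * r by rewrite mulr_ge0 ?(ltW r0)// mulr_ge0// ltW.
have S0 : 0 <= K * (2 * n%:R * expR (l * r)).
  by rewrite mulr_ge0 ?(ltW K0)// mulr_ge0 ?expR_ge0// mulr_ge0.
rewrite mulrAC in NB.
apply: (le_trans (ler_wpM2r S0 (expR_power_decay N0 A4 NB))).
apply: (@le_trans _ _ (expR (- ((1 + l) * r)) * (K * (2 * n%:R * expR (l * r))))).
  rewrite ler_wpM2r// ler_expR lerN2 (_ : 2 + l - 1 = 1 + l); last by ring.
  by rewrite ler_wpM2l// addr_ge0.
have -> : expR (- ((1 + l) * r)) * (K * (2 * n%:R * expR (l * r))) =
    2 * n%:R * K * (expR (- ((1 + l) * r)) * expR (l * r)) by ring.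
rewrite -expRD (_ : - ((1 + l) * r) + l * r = - r); last by ring.
apply: (@le_trans _ _ (2 * n%:R * K * r^-1)).
  by rewrite ler_wpM2l ?inv_expR_le// mulr_ge0 ?(ltW K0)// mulr_ge0.
rewrite ler_pdivrMr//; move: rK; rewrite ler_pdivrMr//; lra.
Qed.

(** J > 4 n r keeps the nodes within 1 / (2 n) of x in each coordinate, and
    N > (B + 1) r gives the remainder the decay e^(-(1 + l) N), which beats
    the growth e^(l r) of the weight (remainder_le). *)
Lemma value_lower_bound (A K l mu : R) w x y : (0 < n)%N ->
  0 < A -> 0 < K -> 0 <= l -> 0 < mu -> diff_bound A K l w ->
  far_radius A K l mu <= enorm x -> (forall j, `|y 0 j| <= 1) ->
  mu < cmod (w y 0) ->
  exists2 z : 'rV[R]_n, (forall j, `|z 0 j - x 0 j| <= (2 * n%:R)^-1) &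
    expR (- (value_rate A l * (enorm x * ln (enorm x)))) <= cmod (w z 0).
Proof.
move=> n0 A0 K0 l0 mu0 wD hr y1 wy; have xr j := coord_le_enorm x j.
have [[re rn rmu rK _] _] := far_radius_le n0 A0 K0 mu0 hr.
move: re rn rmu rK xr {hr}; set r := enorm x => re rn rmu rK xr.
have nn1 : 1 <= n%:R :> R by rewrite ler1n.
have r1 : 1 <= r by have := expR_ge1Dx (1 : R); lra.
have r0 : 0 < r by lra.
pose B := 4 * A * expR (2 + l).
have B0 : 0 <= B by rewrite mulr_ge0 ?expR_ge0// mulr_ge0// ltW.
have Br : 0 <= B * r by rewrite mulr_ge0// ltW.
pose N := (Num.trunc (B * r + r)).+1.
have N1 : B * r + r < N%:R by exact: truncnS_gt.
have N2 : N%:R <= (B + 2) * r.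
  have : (Num.trunc (B * r + r))%:R <= B * r + r by rewrite truncn_le addr_ge0// ltW.
  rewrite /N -natr1; lra.
have nr : r <= n%:R * r by rewrite ler_peMl// ltW.
pose J := (Num.trunc (4 * n%:R * r)).+1.
have J1 : 4 * n%:R * r < J%:R by exact: truncnS_gt.
have J2 : J.+1%:R <= 6 * n%:R * r.
  have : (Num.trunc (4 * n%:R * r))%:R <= 4 * n%:R * r.
    by rewrite truncn_le mulr_ge0 ?(ltW r0)// mulr_ge0.
  rewrite /J -2!natr1; lra.
have N0 : (0 < N)%N by []. have J0 : (0 < J)%N by [].
clearbody N J.
have hN : expR N%:R * (4 * A * r / N%:R) ^+ N * (K * (2 * n%:R * expR (l * r))) <= mu / 2.
  apply: remainder_le => //; rewrite -?/B; lra.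
have rJ : 2 * r <= J%:R by lra.
have yr j : `|y 0 j| <= r by rewrite (le_trans (y1 j)).
have [z zx wz] := exists_large_point A0 K0 l0 wD N0 J0 r0 rJ mu0 xr yr wy hN.
exists z => [j|].
  apply: (le_trans (zx j)).
  rewrite ler_pdivrMr ?ltr0n// [_^-1 * _]mulrC ler_pdivlMr ?mulr_gt0 ?ltr0n//; lra.
have B2 : 0 <= B + 2 by rewrite addr_ge0.
exact: le_trans (node_value_lower nn1 mu0 B2 N2 J2 re rn rmu) wz.
Qed.

Lemma cube_sub_eball (x z : 'rV[R]_n) (a h : R) : (0 < n)%N -> a + h < n%:R^-1 ->
  (forall j, `|z 0 j - x 0 j| <= a) ->
  forall v : 'rV[R]_n, (forall j, `|v 0 j - z 0 j| <= h) -> eball x 1 v.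
Proof.
move=> n0 ah zx v vz; rewrite /eball/=.
apply: (@le_lt_trans _ _ (n%:R * (a + h))); last first.
  by rewrite mulrC -ltr_pdivlMr ?ltr0n// div1r.
apply: enorm_le => j; rewrite !mxE.
have -> : v 0 j - x 0 j = (z 0 j - x 0 j) + (v 0 j - z 0 j) by ring.
by rewrite (le_trans (ler_normD _ _))// lerD.
Qed.

(** The Lipschitz constant at distance r is of the order of e^(l r), so the
    value e^(-a T), T = r ln r, is kept up to a factor 2 on a cube of half side
    e^(-(a + 1 + l) T).  The integral over this cube is the lower bound. *)
Lemma integral_lower_bound (A K l mu : R) w x y : (0 < n)%N ->
  0 < A -> 0 < K -> 0 <= l -> 0 < mu -> diff_bound A K l w ->
  far_radius A K l mu <= enorm x -> (forall j, `|y 0 j| <= 1) ->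
  mu < cmod (w y 0) ->
  ((expR (- (integral_rate A l * enorm x * ln (enorm x))))%:E
    <= integral_rV (eball x 1) (fun x => cmod (w x 0) ^+ 2)%R)%E.
Proof.
move=> n0 A0 K0 l0 mu0 wD hr y1 wy; have xr j := coord_le_enorm x j.
have [[re _ _ _ rA] r4] := far_radius_le n0 A0 K0 mu0 hr.
have [z zx ez] := value_lower_bound n0 A0 K0 l0 mu0 wD hr y1 wy.
move: re rA r4 xr ez {hr}; set r := enorm x => re rA r4 xr.
rewrite /integral_rate; set a := value_rate A l; set T := r * ln r.
set e2 := expR _ => ez.
have a0 : 0 <= a by exact: value_rate_ge0.
have nn1 : 1 <= n%:R :> R by rewrite ler1n.
have nn0 : 0 < n%:R :> R by rewrite ltr0n.
have r1 : 1 <= r by have := expR_ge1Dx (1 : R); lra.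
have r0 : 0 < r by lra.
have L1 : 1 <= ln r by rewrite -[X in X <= _](expRK 1) ler_ln ?posrE ?expR_gt0.
have Tr : r <= T by rewrite ler_peMr// ltW.
have TL : ln r <= T by rewrite ler_peMl//; lra.
have T0 : 0 < T by lra.
pose h := expR (- ((a + 1 + l) * T)).
have hinv : h <= r^-1.
  apply: le_trans (inv_expR_le r0).
  rewrite ler_expR lerN2 (le_trans Tr)// ler_peMl ?(ltW T0)//; lra.
have h4 : h <= (4 * n%:R)^-1.
  by apply: (le_trans hinv); rewrite lef_pV2 ?posrE// mulr_gt0.
have h1 : 0 < h <= 1 by rewrite expR_gt0 (le_trans hinv)// invf_le1.
have hA : A * h * K * coshsum l z <= e2 / 2.
  have zr j : `|z 0 j| <= r + 1.
    rewrite -[z 0 j](subrK (x 0 j)) (le_trans (ler_normD _ _))// addrC lerD ?xr//.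
    by rewrite (le_trans (zx j))// invf_le1 ?mulr_gt0//; lra.
  apply: (@le_trans _ _ (A * h * K * (2 * n%:R * expR (l * (r + 1))))).
    rewrite ler_wpM2l ?coshsum_le// mulr_ge0 ?(ltW K0)// mulr_ge0 ?(ltW A0)//.
    exact: expR_ge0.
  have hE : h = e2 * expR (- ((1 + l) * T)).
    by rewrite /h /e2 -expRD; congr expR; ring.
  have -> : A * h * K * (2 * n%:R * expR (l * (r + 1))) =
      e2 / 2 * ((4 * n%:R * A * K * expR l) * expR (l * r) * expR (- ((1 + l) * T))).
    by rewrite hE mulrDr mulr1 expRD; field.
  rewrite ler_piMr ?divr_ge0 ?expR_ge0//.
  apply: (@le_trans _ _ (r * expR (l * r) * expR (- ((1 + l) * T)))).
    by rewrite ler_pM2r ?expR_gt0// ler_pM2r ?expR_gt0.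
  rewrite -{1}[r]lnK ?posrE// -!expRD -[X in _ <= X]expR0 ler_expR.
  have : l * r <= l * T by rewrite ler_wpM2l.
  lra.
have zh : (2 * n%:R)^-1 + h < n%:R^-1.
  move: h4; rewrite !invfM; have : 0 < n%:R^-1 :> R by rewrite invr_gt0.
  lra.
have e20 : 0 <= e2 by exact: expR_ge0.
apply: le_trans (integral_ge_point wD h1 e20 hA ez (cube_sub_eball n0 zh zx)).
rewrite lee_fin.
have -> : - ((2 + 2 * a + (a + 1 + l) * n%:R) * r * ln r) =
  (- T - T) + (- (a * T) * 2 + - ((a + 1 + l) * T) * n%:R) by rewrite /T; ring.
have hT : expR (- T) <= 2^-1.
  by apply: (le_trans (inv_expR_le T0)); rewrite lef_pV2 ?posrE//; have := expR_ge1Dx (1 : R); lra.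
rewrite !expRD !expRM_natr -/h -/e2 [X in X * (2 * h) ^+ n]exprMn mulrCA -[X in _ <= X]mulrA.
have /andP[h0 _] := h1.
rewrite ler_wpM2l ?sqr_ge0//; apply: ler_pM; rewrite ?mulr_ge0 ?expR_ge0 ?exprn_ge0 ?(ltW h0)//.
  by rewrite expr2; apply: ler_pM; rewrite ?expR_ge0.
by apply: lerXn2r; rewrite ?nnegrE; lra.
Qed.

(** A nonzero value in the ball would give a positive integral, so w vanishes on
    a cube about the origin, and zero_of_zero_on_cube extends this to R^n. *)
Lemma zero_of_integral_le0 (A K l m : R) w : (0 < n)%N ->
  0 < A -> 0 < K -> 0 <= l -> diff_bound A K l w ->
  integral_rV (eball 0 1) (fun x => cmod (w x 0) ^+ 2)%R = m%:E -> m <= 0 ->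
  forall y, w y 0 = 0.
Proof.
move=> n0 A0 K0 l0 wD hm m0.
have n1' : 0 < n%:R :> R by rewrite ltr0n.
have n4 : 0 < (4 * n%:R)^-1 :> R by rewrite invr_gt0 mulr_gt0.
apply: (zero_of_zero_on_cube A0 K0 l0 wD n4) => z hz.
apply: contrapT => uz.
have wz : 0 < cmod (w z 0).
  rewrite lt0r cmod_ge0 andbT; apply/eqP => h; apply: uz; exact: Normc.eq0_normc.
set cz := cmod (w z 0) in wz.
set X := A * K * coshsum l z.
have X0 : 0 <= X by rewrite mulr_ge0 ?coshsum_ge0// mulr_ge0// ltW.
pose q := 2 * (X + 1) / cz + 4 * n%:R.
have q1 : 0 < 2 * (X + 1) / cz by rewrite divr_gt0// mulr_gt0//; lra.
have q4 : 4 * n%:R < q by rewrite ltrDr.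
have n1 : 1 <= n%:R :> R by rewrite ler1n.
have q0 : 0 < q by lra.
have hq : 0 < q^-1 <= 1 by rewrite invr_gt0 q0 invf_le1//; lra.
have hA : A * q^-1 * K * coshsum l z <= cz / 2.
  have -> : A * q^-1 * K * coshsum l z = X / q by rewrite /X; ring.
  rewrite ler_pdivrMr//; apply: (@le_trans _ _ (X + 1)); first by rewrite lerDl.
  have -> : X + 1 = cz / 2 * (2 * (X + 1) / cz) by field; rewrite lt0r_neq0.
  by rewrite ler_pM2l ?divr_gt0// lerDl mulr_ge0.
have zh : (4 * n%:R)^-1 + q^-1 < n%:R^-1.
  have : q^-1 < (4 * n%:R)^-1 by rewrite ltf_pV2 ?posrE ?mulr_gt0.
  have : 0 < n%:R^-1 :> R by rewrite invr_gt0.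
  rewrite !invfM; lra.
have hz0 j : `|z 0 j - (0 : 'rV[R]_n) 0 j| <= (4 * n%:R)^-1 by rewrite mxE subr0.
have := integral_ge_point wD hq (ltW wz) hA (lexx _) (cube_sub_eball n0 zh hz0).
rewrite hm lee_fin leNgt => /negP; apply; apply: (le_lt_trans m0).
by rewrite mulr_gt0 ?exprn_gt0 ?divr_gt0 ?mulr_gt0// invr_gt0.
Qed.

(** The unit ball is contained in a cube of volume 2^n. *)
Lemma exists_point_of_integral (m : R) w : 0 < m ->
  integral_rV (eball 0 1) (fun x => cmod (w x 0) ^+ 2)%R = m%:E ->
  exists2 y : 'rV[R]_n, forall j, `|y 0 j| <= 1 & Num.sqrt (m / 2 ^+ n.+1) < cmod (w y 0).
Proof.
move=> m0 hm; set mu := Num.sqrt _.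
have mq : 0 < m / 2 ^+ n.+1 by rewrite divr_gt0// exprn_gt0.
apply: contrapT => ny.
have : (integral_rV (eball 0 1) (fun x => cmod (w x 0) ^+ 2)%R
    <= (m / 2 ^+ n.+1 * (2 * 1) ^+ n)%:E)%E.
  apply: (integral_rV_le (z := 0)); rewrite ?ler01 ?(ltW mq)//.
    by move=> x; exact: sqr_ge0.
  move=> x; rewrite /eball/= subr0 => /ltW x1.
  have xj j : `|x 0 j| <= 1 by exact: le_trans (coord_le_enorm x j) x1.
  split => [j|]; first by rewrite mxE subr0.
  have : cmod (w x 0) <= mu by rewrite leNgt; apply/negP => h; apply: ny; exists x.
  rewrite -[m / _]sqr_sqrtr ?(ltW mq)// -/mu => h.
  by apply: lerXn2r; rewrite ?nnegrE ?cmod_ge0 ?sqrtr_ge0.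
have p0 : 0 < 2 ^+ n :> R by rewrite exprn_gt0.
have -> : m / 2 ^+ n.+1 * (2 * 1) ^+ n = m / 2.
  by rewrite mulr1 exprS; field; rewrite lt0r_neq0.
rewrite hm lee_fin; lra.
Qed.

End lowerbound.

Theorem theorem1p3 (R : realType) (n : nat) (C b c m : R) (hC : 0 <= C) :
  exists Ct R0 : R, 0 < Ct /\
    forall (c0 : R[i]) (b0 : 'rV[R[i]]_n) (u : 'rV[R]_n -> R -> R[i]),
      cmod c0 = c ->
      cenorm b0 = b ->
      is_solution c0 b0 u ->
      (exists x : 'rV[R]_n, u x 0 <> 0) ->
      (forall (x : 'rV[R]_n) (t : R), 0 <= t ->
        cmod (u x t) <= C * expR (C * (enorm x + Num.sqrt `|t|))) ->
      integral_rV (eball 0 1) (fun x => cmod (u x 0) ^+ 2) = m%:E ->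
      forall x0 : 'rV[R]_n, R0 <= enorm x0 ->
        ((expR (- (Ct * enorm x0 * ln (enorm x0))))%:E
          <= integral_rV (eball x0 1) (fun x => cmod (u x 0) ^+ 2)%R)%E.
Proof.
(* in dimension 0 no point has norm at least 1 *)
have [n_eq0|n0] := posnP n.
  exists 1, 1; split => // c0 b0 u _ _ _ _ _ _ x0.
  have -> : enorm x0 = 0.
    by rewrite /enorm big1 ?sqrtr0// => j _; have := ltn_ord j; rewrite {2}n_eq0.
  by rewrite ler10.
have [A A0 HA] := @solution_diff_bound R n C b c n0 hC.
pose K := (C * expR C + 1) * expR (C * n%:R); pose l := C * n%:R.
have K0 : 0 < K by rewrite mulr_gt0 ?expR_gt0// ltr_wpDl// mulr_ge0// expR_ge0.
have l0 : 0 <= l by rewrite mulr_ge0.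
(* for m <= 0 there is no such solution *)
have [m0|m0] := leP m 0.
  exists 1, 1; split => // c0 b0 u hc hb us [y uy] hu hm.
  have uD := HA c0 b0 u hc hb us hu; rewrite -/K -/l in uD.
  by case: uy; exact: (zero_of_integral_le0 n0 A0 K0 l0 uD hm m0).
pose mu := Num.sqrt (m / 2 ^+ n.+1).
have mu0 : 0 < mu by rewrite sqrtr_gt0 divr_gt0// exprn_gt0.
exists (integral_rate n A l), (far_radius n A K l mu); split.
  have v0 := value_rate_ge0 l A0.
  by rewrite /integral_rate ltr_wpDr ?mulr_ge0//; lra.
move=> c0 b0 u hc hb us _ hu hm x0 hx0.
have uD := HA c0 b0 u hc hb us hu; rewrite -/K -/l in uD.
have [y y1 uy] := exists_point_of_integral m0 hm.
exact: (integral_lower_bound n0 A0 K0 l0 mu0 uD hx0 y1 uy).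
Qed.
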